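(* There is a constant $C_0$, dependent on $\Lambda$ but independent of $\rho(x)$ and $\delta$, such that for any given $u\in V_h$ there exist $u_0\in V_{glb}$ and $u_i\in V_0(\Omega_i')$, $i=1,\dots,N$ (extended by zero to $\Omega$), such that $$u=\sum_{i=1}^Nu_i+u_0$$ and $$\sum_{i=1}^Na(u_i,u_i)+a(u_0,u_0)\le C_0^2\,a(u,u).$$
   Context: Setting. $\Omega\subset\mathbb{R}^r$ is a bounded polygonal (polyhedral) domain and $\rho(x)>0$ is a coefficient on $\Omega$. $\mathcal T_h$ is a conforming triangulation of $\Omega$ into simplices (''triangles'') $\tau$; $V_h$ is the space of continuous functions that are affine on each $\tau\in\mathcal T_h$ and vanish on $\partial\Omega$; $I^h$ is nodal (Lagrange) interpolation into continuous piecewise linear functions on $\mathcal T_h$. For a given constant $C_\rho$, $\max_{x\in\tau}\rho(x)/\min_{x\in\tau}\rho(x)\le C_\rho$ for all $\tau\in\mathcal T_h$. Put $a(v,w)=\int_\Omega\rho\nabla v\cdot\nabla w\,dx$. Subdomains. $\Omega$ is partitioned into non-overlapping subdomains $\Omega_1,\dots,\Omega_N$, each a connected union of simplices of $\mathcal T_h$. $\Omega_i'$ is obtained by extending $\Omega_i$ by several layers of simplices of $\mathcal T_h$; $2\delta$ is the minimum overlapping width of the overlapping partition $\{\Omega_i'\}$. $V_0(\Omega_i')$ is the space of restrictions to $\Omega_i'$ of functions of $V_h$, with zero value on $\partial\Omega_i'$. $\{\theta_i\}_{i=1}^N$ is a partition of unity: each $\theta_i$ is continuous, affine on each $\tau\in\mathcal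 T_h$, $0\le\theta_i\le1$, supported in $\Omega_i'$, and $\sum_i\theta_i=1$ on $\Omega$ (for instance, $\theta_i(x)=1/\mathcal N(x)$ at nodes $x$ interior to $\Omega_i'$ and $0$ at the other nodes, $\mathcal N(x)$ being the number of overlapping subdomains containing $x$). Auxiliary functions. $V(\Omega_i)$ is the restriction of $V_h$ to $\Omega_i$; $a_i(v,w)=\int_{\Omega_i}\rho\nabla v\cdot\nabla w\,dx$; $s_i(v,w)=\int_{\Omega_i}\rho\sum_{l\in n(i)}|\nabla\theta_l|^2vw\,dx$, where $n(i)$ is the set of $l$ such that the support of $\theta_l$ meets $\Omega_i$. Consider the generalized eigenvalue problem $a_i(\phi_j^{(i)},w)=\lambda_j^{(i)}s_i(\phi_j^{(i)},w)$ for all $w\in V(\Omega_i)$, with eigenvalues in ascending order. Given a tolerance $\Lambda>0$, let $\phi_1^{(i)},\dots,\phi_{l_i}^{(i)}$ be the $s_i$-orthonormal eigenfunctions with $\lambda_j^{(i)}<\Lambda$. Put $\pi_k\psi=\sum_{j=1}^{l_k}s_k(\psi,\phi_j^{(k)})\phi_j^{(k)}$. Global coarse space. $\psi_j^{(i)}\in V_h$ is the minimizer over $\psi\in V_h$ of $a(\psi,\psi)+s_i(\pi_i\psi-\phi_j^{(i)},\pi_i\psi-\phi_j^{(i)})+\sum_{k\ne i}s_k(\pi_k\psi,\pi_k\psi)$, equivalently the solution of $a(\psi_j^{(i)},v)+\sum_{k=1}^Ns_k(\pi_k\psi_j^{(i)},\pi_kv)=s_i(\phi_j^{(i)},\pi_iv)$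 for all $v\in V_h$. $V_{glb}=\mathrm{span}\{\psi_j^{(i)}: 1\le i\le N,1\le j\le l_i\}$. Constants. Besides $\Lambda$, $C_0$ may depend only on $C_\rho$, the elementwise stability constant of $I^h$ in the $H^1$-seminorm and $L^2$-norm (on products of affine functions), and the maximum number of overlapping subdomains sharing a common location. *)

(* Defs.v *)
From HB Require Import structures.
From mathcomp Require Import all_boot all_order all_algebra.
From mathcomp Require Import all_classical all_reals all_analysis.
Set Implicit Arguments.
Unset Strict Implicit.
Unset Printing Implicit Defensive.
Import Order.TTheory GRing.Theory Num.Theory.
Import numFieldNormedType.Exports.
Local Open Scope classical_set_scope.
Local Open Scope ring_scope.

(* The library has no n-dimensional Lebesgue measure: it is built here on
   [n.-tuple R] (product sigma-algebra) by iterating the product measure;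
   [leb_box] gives its value on boxes. *)
Section lebesgue.
Context {R : realType}.
Notation RT := (measurableTypeR R).

Definition tcons n (p : RT * n.-tuple RT) : n.+1.-tuple RT :=
  [tuple of p.1 :: p.2].

Lemma measurable_tcons n : measurable_fun setT (@tcons n).
Proof. exact: measurable_cons. Qed.

Section step.
Variables (lam : {sigma_finite_measure set RT -> \bar R}) (n : nat).
Variable (mu : {sigma_finite_measure set (n.-tuple RT) -> \bar R}).

Definition leb_step : set (n.+1.-tuple RT) -> \bar R :=
  pushforward (lam \x mu)%E (@tcons n).

Let preimage_tcons A : measurable A -> measurable (@tcons n @^-1` A).
Proof.
by move=> mA; rewrite -[X in measurable X]setTI; exact: measurable_tcons.
Qed.

Let leb_step0 : leb_step set0 = 0%E.
Proof. by rewrite /leb_step /pushforward preimage_set0 measure0. Qed.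

Let leb_step_ge0 A : (0 <= leb_step A)%E.
Proof.
by rewrite /leb_step /pushforward; apply: (@measure_ge0 _ _ _ (lam \x mu)%E).
Qed.

Let leb_step_sigma_additive : semi_sigma_additive leb_step.
Proof.
move=> F mF tF mUF; rewrite /leb_step /pushforward preimage_bigcup.
apply: (@measure_semi_sigma_additive _ _ _ (lam \x mu)%E
  (fun i => @tcons n @^-1` F i)).
- by move=> i; exact: preimage_tcons.
- apply/trivIsetP => /= i j _ _ ij; rewrite -preimage_setI.
  by move/trivIsetP : tF => /(_ _ _ _ _ ij) ->//; rewrite preimage_set0.
- by rewrite -preimage_bigcup; exact: preimage_tcons.
Qed.

HB.instance Definition _ := isMeasure.Build _ _ _ leb_step
  leb_step0 leb_step_ge0 leb_step_sigma_additive.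

Let leb_step_sigma_finite : sigma_finite setT leb_step.
Proof.
have /sigma_finiteP[F [TF ndF Foo]] := sigma_finiteT lam.
have /sigma_finiteP[G [TG ndG Goo]] := sigma_finiteT mu.
pose unc (t : n.+1.-tuple RT) : RT * n.-tuple RT :=
    (thead t, [tuple of behead t]).
have munc : measurable_fun setT unc.
  apply/measurable_fun_pair; first exact: measurable_tnth.
  exact: measurable_behead.
exists (fun k => unc @^-1` (F k `*` G k)).
  rewrite -preimage_bigcup (_ : \bigcup_k _ = setT) ?preimage_setT//.
  apply/seteqP; split=> // -[x y] _.
  have [k _ Fkx] : (\bigcup_k F k) x by rewrite -TF.
  have [l _ Gly] : (\bigcup_k G k) y by rewrite -TG.
  exists (maxn k l) => //; split=> /=.
  - by move: x Fkx; exact/subsetPset/ndF/leq_maxl.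
  - by move: y Gly; exact/subsetPset/ndG/leq_maxr.
move=> k; have [mF Fk] := Foo k; have [mG Gk] := Goo k; split.
  by rewrite -[X in measurable X]setTI; apply: munc => //; exact: measurableX.
rewrite /leb_step /pushforward -comp_preimage.
rewrite (_ : unc \o _ = id) ?preimage_id//=.
  by rewrite product_measure1E// lte_mul_pinfty// ge0_fin_numE.
apply/funext => -[x t]; congr (_, _); last exact/val_inj.
Qed.

HB.instance Definition _ := Measure_isSigmaFinite.Build _ _ _ leb_step
  leb_step_sigma_finite.
End step.

Fixpoint leb n : {sigma_finite_measure set (n.-tuple RT) -> \bar R} :=
  if n is m.+1 then leb_step (@lebesgue_measure R) (leb m)
  else \d_([tuple] : 0.-tuple RT).

Lemma leb_box n (I : 'I_n -> interval R) :
  leb n [set t | forall i, tnth t i \in I i] =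
  (\prod_(i < n) lebesgue_measure [set` I i])%E.
Proof.
elim: n I => [|n IH] I /=.
  by rewrite big_ord0 diracE mem_set//= => -[].
pose B := [set t : n.-tuple RT | forall i, tnth t i \in I (lift ord0 i)].
have mB : measurable B.
  rewrite (_ : B = \bigcap_(i in [set: 'I_n])
      ((fun t : n.-tuple RT => tnth t i) @^-1` [set` I (lift ord0 i)])); last first.
    by apply/seteqP; split=> t Bt i => [_|]; exact: Bt.
  apply: fin_bigcap_measurable => // i _.
  rewrite -[X in measurable X]setTI.
  by apply: measurable_tnth => //; exact: measurable_itv.
rewrite big_ord_recl -IH -product_measure1E//.
congr ((_ \x _)%E _); apply/seteqP; split=> -[x t] /=.
- move=> tI; split; first exact: (tI ord0).
  by move=> i; have := tI (lift ord0 i); rewrite tnthS.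
- move=> [xI tI] i; have [j ->|->] := unliftP ord0 i; last exact: xI.
  by rewrite tnthS; exact: tI.
Qed.
End lebesgue.

Section points.
Context {R : realType} {d : nat}.
Implicit Types (f : 'rV[R]_d -> R) (v : 'I_d.+1 -> 'rV[R]_d) (x y : 'rV[R]_d).

Definition point_of (t : d.-tuple (measurableTypeR R)) : 'rV[R]_d :=
  \row_i tnth t i.

Definition lebesgue_int (A : set 'rV[R]_d) f : R :=
  \int[leb d]_(t in point_of @^-1` A) f (point_of t).

Definition borel_on (A : set 'rV[R]_d) f : Prop :=
  measurable_fun (point_of @^-1` A) (f \o point_of).

Definition dot x y : R := \sum_i x ord0 i * y ord0 i.

Definition grad f x : 'rV[R]_d := \row_i 'D_(delta_mx ord0 i) f x.

Definition frontier (A : set 'rV[R]_d) : set 'rV[R]_d := closure A `\` A°.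

(* The closed face, spanned by the vertices in J, of the simplex with
   vertices v *)
Definition face v (J : {set 'I_d.+1}) : set 'rV[R]_d :=
  [set x | exists c : 'I_d.+1 -> R,
    [/\ forall j, 0 <= c j, forall j, j \notin J -> c j = 0,
        \sum_j c j = 1 & x = \sum_j c j *: v j]].

Definition affinely_independent v : bool :=
  row_free (\matrix_(j < d) (v (lift ord0 j) - v ord0)).

End points.

(* omega is an open set, the simplices and the subdomains are closed sets;
   the subdomain omega_i is given by the simplices t with [dom t = i], and the
   overlapping subdomain omega_i' by adding [layers i] layers of simplices.
   The overlap width 2 delta is a function of these data. *)
Record schwarz_data (R : realType) (d : nat) := SchwarzData {
  omega : set 'rV[R]_d;
  rho : 'rV[R]_d -> R;
  mesh : finType;
  vtx : mesh -> 'I_d.+1 -> 'rV[R]_d;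
  nsub : nat;
  dom : mesh -> 'I_nsub;
  layers : 'I_nsub -> nat;
  theta : 'I_nsub -> 'rV[R]_d -> R }.
Arguments vtx {R d} s t : rename.
Arguments dom {R d} s t : rename.
Arguments layers {R d} s i : rename.
Arguments theta {R d} s i x : rename.
Arguments rho {R d} s x : rename.

Section definitions.
Context {R : realType} {d : nat} (D : schwarz_data R d).
Implicit Types (t : mesh D) (S : {set mesh D}) (i k : 'I_(nsub D)).
Implicit Types (f g p q u v w : 'rV[R]_d -> R).

Definition cell t : set 'rV[R]_d := face (vtx D t) [set: 'I_d.+1]%SET.

Definition shared t t' : {set 'I_d.+1} :=
  [set j | [exists k, vtx D t j == vtx D t' k]]%SET.

Definition polyhedral_domain : Prop :=
  [/\ open (omega D), connected (omega D) & omega D !=set0].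

(* The last clause says that the mesh resolves the boundary. It is automatic
   if omega is the interior of its closure; otherwise (slit domains) it is part
   of what a triangulation of omega means. Boundedness of omega follows from
   the fourth clause. *)
Definition conforming_triangulation : Prop :=
  [/\ forall t, affinely_independent (vtx D t),
      forall t t', shared t t' = [set: 'I_d.+1]%SET -> t = t',
      forall t t', cell t `&` cell t' `<=` face (vtx D t) (shared t t'),
      closure (omega D) = \bigcup_t cell t &
      forall x, frontier (omega D) x ->
        exists t (J : {set 'I_d.+1}),
          [/\ J != [set: 'I_d.+1]%SET, face (vtx D t) J x &
              face (vtx D t) J `<=` frontier (omega D)]].

(* The ratio is bounded on open simplices, so that rho may jump across faces. *)
Definition admissible_coefficient (C_rho : R) : Prop :=
  [/\ borel_on (omega D) (rho D),
      forall x, omega D x -> 0 < rho D x &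
      forall t x y, (cell t)° x -> (cell t)° y ->
        rho D x <= C_rho * rho D y].

Definition region S : set 'rV[R]_d := \bigcup_(t in [set` S]) cell t.

(* [region S] minus a null set, off which gradients of piecewise affine
   functions need not exist *)
Definition open_cells S : set 'rV[R]_d := \bigcup_(t in [set` S]) (cell t)°.

Definition affine_on t f : Prop :=
  exists (a : 'rV[R]_d) (b : R), forall x, cell t x -> f x = dot a x + b.

(* Functions of V_h are extended by zero outside omega. *)
Definition Vh f : Prop :=
  [/\ continuous f, forall t, affine_on t f &
      forall x, ~ omega D x -> f x = 0].

Definition a_on S v w : R :=
  lebesgue_int (open_cells S)
    (fun x => rho D x * dot (grad v x) (grad w x)).

Definition a_form v w : R := a_on [set: mesh D]%SET v w.

Definition subdomain i : {set mesh D} := [set t | dom D t == i]%SET.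

Definition subdomain_partition : Prop :=
  forall i, (exists t, t \in subdomain i) /\
            connected (region (subdomain i)).

Definition add_layer S : {set mesh D} :=
  [set t | [exists t' in S, shared t t' != finset.set0]]%SET.

Definition overlapping_subdomain i : {set mesh D} :=
  iter (layers D i) add_layer (subdomain i).

Definition overlap_bound (M : nat) : Prop :=
  forall x, (#|[set i | `[< (region (overlapping_subdomain i))° x >]]%SET|
             <= M)%N.

Definition V0 i u : Prop :=
  exists g, [/\ Vh g,
    forall x, frontier (region (overlapping_subdomain i)) x -> g x = 0,
    forall x, region (overlapping_subdomain i) x -> u x = g x &
    forall x, ~ region (overlapping_subdomain i) x -> u x = 0].

Definition supp f : set 'rV[R]_d :=
  closure [set x | closure (omega D) x /\ f x != 0].

Definition partition_of_unity : Prop :=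
  [/\ forall i, {within closure (omega D), continuous (theta D i)},
      forall i t, affine_on t (theta D i),
      forall i x, omega D x -> 0 <= theta D i x <= 1,
      forall i, supp (theta D i) `<=` region (overlapping_subdomain i) &
      forall x, omega D x -> \sum_i theta D i x = 1].

Definition L2_norm t f : R :=
  Num.sqrt (lebesgue_int (cell t)° (fun x => f x ^+ 2)).

Definition H1_seminorm t f : R :=
  Num.sqrt (lebesgue_int (cell t)° (fun x => dot (grad f x) (grad f x))).

Definition nodal_interpolant t f g : Prop :=
  affine_on t g /\ forall j, g (vtx D t j) = f (vtx D t j).

Definition interpolation_stable (C_I : R) : Prop :=
  forall t p q g, affine_on t p -> affine_on t q ->
    nodal_interpolant t (p \* q) g ->
    H1_seminorm t g <= C_I * H1_seminorm t (p \* q) /\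
    L2_norm t g <= C_I * L2_norm t (p \* q).

(* V(omega_i): only the values on omega_i matter. *)
Definition V_sub i f : Prop :=
  exists2 g, Vh g & forall x, region (subdomain i) x -> f x = g x.

Definition a_sub i v w : R := a_on (subdomain i) v w.

Definition neighbours i : {set 'I_(nsub D)} :=
  [set l | `[< supp (theta D l) `&` region (subdomain i) !=set0 >]]%SET.

Definition s_sub i v w : R :=
  lebesgue_int (open_cells (subdomain i))
    (fun x => rho D x *
       (\sum_(l in neighbours i) dot (grad (theta D l) x) (grad (theta D l) x)) *
       v x * w x).

Definition eigenpair i (mu : R) f : Prop :=
  V_sub i f /\ forall w, V_sub i w -> a_sub i f w = mu * s_sub i f w.

(* The last clause is completeness: no further eigenfunction below Lambda can
   be added to the s_i-orthonormal family. *)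
Definition low_eigenfunctions (Lambda : R) i (l : nat)
    (lambda : 'I_l -> R) (phi : 'I_l -> 'rV[R]_d -> R) : Prop :=
  [/\ forall j, eigenpair i (lambda j) (phi j) /\ lambda j < Lambda,
      forall j j' : 'I_l, (j <= j')%N -> lambda j <= lambda j',
      forall j j', s_sub i (phi j) (phi j') = (j == j')%:R &
      forall mu f, eigenpair i mu f -> mu < Lambda ->
        (forall j, s_sub i f (phi j) = 0) -> s_sub i f f = 0].

Section coarse_space.
Variables (l : 'I_(nsub D) -> nat) (phi : forall i, 'I_(l i) -> 'rV[R]_d -> R).

Definition spectral_proj k f : 'rV[R]_d -> R :=
  fun x => \sum_j s_sub k f (phi j) * @phi k j x.

Definition energy i (j : 'I_(l i)) f : R :=
  a_form f f +
  s_sub i (spectral_proj i f \- phi j) (spectral_proj i f \- phi j) +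
  \sum_(k | k != i) s_sub k (spectral_proj k f) (spectral_proj k f).

Definition energy_minimizer i (j : 'I_(l i)) f : Prop :=
  Vh f /\ forall v, Vh v -> energy j f <= energy j v.

Definition V_glb (psi : forall i, 'I_(l i) -> 'rV[R]_d -> R) f : Prop :=
  exists c : forall i, 'I_(l i) -> R,
    forall x, f x = \sum_i \sum_j c i j * psi i j x.

End coarse_space.
End definitions.

(* Main.v *)
Require Import Defs.
From mathcomp Require Import all_boot all_order all_algebra.
From mathcomp Require Import all_classical all_reals all_analysis measurable_realfun.
From mathcomp Require Import ring lra.
Set Implicit Arguments.
Unset Strict Implicit.
Unset Printing Implicit Defensive.
Import Order.TTheory GRing.Theory Num.Theory.
Import numFieldNormedType.Exports.
Local Open Scope classical_set_scope.
Local Open Scope ring_scope.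

(** The coarse component is u0, the sum of the s_i (u, phi_j^i) psi_j^i. The
    Euler-Lagrange equations of the minimizers psi_j^i add up to
      a (u0, v) + sum_k s_k (pi_k u0, pi_k v) = sum_k s_k (pi_k u, pi_k v)
    for all v in V_h. Taking for v the remainder e = u - u0 gives
    a (u0, e) = sum_k s_k (pi_k e, pi_k e), hence the Pythagorean identity
      a (u0, u0) + a (e, e) + 2 sum_k s_k (pi_k e, pi_k e) = a (u, u)
    ([coarse_projection]), which bounds u0, e and the low modes of e at once.

    The local components are u_i = I^h (theta_i e). On a cell, the product rule,
    the stability of interpolation and the bounded oscillation of rho bound the
    energy of u_i by the integral of rho (|grad theta_i|^2 e^2 + theta_i^2
    |grad e|^2) up to a constant ([interp_energy]). The squares of the theta_i
    add up to at most 1, and the sum of the |grad theta_i|^2 is the weight of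
    the forms s_k; so the energies of the u_i add up to at most a constant times
    sum_k s_k (e, e) + a (e, e) ([decomposition_energy]).

    There remains s_k (e, e). Its part on the low modes, s_k (pi_k e, pi_k e), is
    bounded above; on the orthogonal complement Lambda s_k <= a_k, as there are
    no further eigenvalues below Lambda ([spectral_gap]). This is the
    variational principle for the next eigenvalue, for a pencil (a_k, s_k) in
    which both forms may be degenerate. It rests on [psd_pencil]: if mu is the
    largest number such that a - mu s is positive semidefinite, then a - mu s
    has a null vector that is not null for s. Altogether
    C0 ^ 2 = 1 + 2 C_rho ^ 2 C_I ^ 2 (2 + 1 / Lambda) will do. *)

(** * Positive semidefinite forms and pencils *)

Section psd_forms.
Context {R : realType} {U : lmodType R}.
Implicit Types (b s q : U -> U -> R) (x y z e : U) (P : U -> U) (c : R).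

Definition psd_form b : Prop :=
  [/\ forall x y, b x y = b y x,
      forall c x y z, b (c *: x + y) z = c * b x z + b y z &
      forall x, 0 <= b x x].

Lemma psd_sym b x y : psd_form b -> b x y = b y x.
Proof. by case. Qed.

Lemma psd_ge0 b x : psd_form b -> 0 <= b x x.
Proof. by case. Qed.

Lemma psd_Dl b x y z : psd_form b -> b (x + y) z = b x z + b y z.
Proof. by case=> _ /(_ 1 x y z); rewrite scale1r mul1r. Qed.

Lemma psd_0l b z : psd_form b -> b 0 z = 0.
Proof.
by move=> bP; apply: (addrI (b 0 z)); rewrite -psd_Dl// !addr0.
Qed.

Lemma psd_Zl b c x z : psd_form b -> b (c *: x) z = c * b x z.
Proof.
by move=> bP; case: (bP) => _ /(_ c x 0 z); rewrite addr0 psd_0l// addr0.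
Qed.

Lemma psd_Bl b x y z : psd_form b -> b (x - y) z = b x z - b y z.
Proof. by move=> bP; rewrite psd_Dl// -scaleN1r psd_Zl// mulN1r. Qed.

Lemma psd_Dr b x y z : psd_form b -> b z (x + y) = b z x + b z y.
Proof. by move=> bP; rewrite psd_sym// psd_Dl// !(psd_sym z). Qed.

Lemma psd_Zr b c x z : psd_form b -> b z (c *: x) = c * b z x.
Proof. by move=> bP; rewrite psd_sym// psd_Zl// (psd_sym z). Qed.

Lemma psd_suml b (I : finType) (f : I -> U) z : psd_form b ->
  b (\sum_i f i) z = \sum_i b (f i) z.
Proof.
move=> bP; elim/big_rec2: _ => [|i w x _ <-]; first exact: psd_0l.
exact: psd_Dl.
Qed.

Lemma psd_sqD b c x y : psd_form b ->
  b (x + c *: y) (x + c *: y) = b x x + 2 * c * b x y + c ^+ 2 * b y y.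
Proof.
move=> bP; rewrite !(psd_Dl, psd_Dr, psd_Zl, psd_Zr)// (psd_sym y)//.
by ring.
Qed.

Lemma psd_le2 b x y : psd_form b -> b (x + y) (x + y) <= 2 * b x x + 2 * b y y.
Proof.
move=> bP; have := psd_sqD (-1) x y bP; have := psd_sqD 1 x y bP.
rewrite scale1r => -> h; have := psd_ge0 (x + (-1) *: y) bP.
by rewrite h; lra.
Qed.

(** Otherwise c |-> b (y + c x, y + c x) would be a nonconstant affine
    function, which takes negative values. *)
Lemma psd_null b x y : psd_form b -> b x x = 0 -> b x y = 0.
Proof.
move=> bP bx; have yy := psd_ge0 y bP.
apply/eqP/negPn/negP => nz.
(* the form takes the value -1 at y + c x *)
pose c := - (b y y + 1) / (2 * b x y).
have := psd_ge0 (y + c *: x) bP.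
rewrite psd_sqD// bx (psd_sym y)// mulr0 addr0 /c.
have -> : 2 * (- (b y y + 1) / (2 * b x y)) * b x y = - (b y y + 1) by field.
by lra.
Qed.

Lemma psd_comp b P : psd_form b ->
  (forall c x y, P (c *: x + y) = c *: P x + P y) ->
  psd_form (fun x y => b (P x) (P y)).
Proof.
move=> bP linP; split=> [x y|c x y z|x].
- exact: psd_sym.
- by rewrite linP; case: bP.
- exact: psd_ge0.
Qed.

Lemma psd_sum (I : finType) (A : pred I) (B : I -> U -> U -> R) :
  (forall i, psd_form (B i)) -> psd_form (fun x y => \sum_(i | A i) B i x y).
Proof.
move=> BP; split=> [x y|c x y z|x].
- by apply: eq_bigr => i _; exact: psd_sym.
- by rewrite mulr_sumr -big_split; apply: eq_bigr => i _; case: (BP i).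
- by apply: sumr_ge0 => i _; exact: psd_ge0.
Qed.

Lemma psd_square (l : U -> R) : (forall c x y, l (c *: x + y) = c * l x + l y) ->
  psd_form (fun x y => l x * l y).
Proof.
move=> linl; split=> [x y|c x y z|x]; first exact: mulrC.
- by rewrite linl mulrDl mulrA.
- by rewrite -expr2 sqr_ge0.
Qed.

Lemma psd_add b s : psd_form b -> psd_form s ->
  psd_form (fun x y => b x y + s x y).
Proof.
move=> bP sP; split=> [x y|c x y z|x].
- by rewrite psd_sym// (psd_sym x).
- by rewrite !(psd_Dl, psd_Zl)//; ring.
- by rewrite addr_ge0// psd_ge0.
Qed.

(** Projection along e onto its b-orthogonal complement, provided that
    b e e != 0. *)
Definition deflate b e x : U := x - (b x e / b e e) *: e.

Lemma deflate_lin b e c x y : psd_form b ->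
  deflate b e (c *: x + y) = c *: deflate b e x + deflate b e y.
Proof.
move=> bP; rewrite /deflate psd_Dl// psd_Zl// scalerBr scalerA mulrDl scalerDl.
by rewrite opprD addrACA mulrA.
Qed.

Lemma deflate_self b e : b e e != 0 -> deflate b e e = 0.
Proof. by move=> be; rewrite /deflate divff// scale1r subrr. Qed.

Lemma deflate_norm b e x : psd_form b -> b e e != 0 ->
  b x x = b (deflate b e x) (deflate b e x) + b x e ^+ 2 / b e e.
Proof.
move=> bP be; rewrite /deflate -scaleNr psd_sqD//; by field.
Qed.

(** Membership in the span, as a recursion that removes one generator at a time,
    the way [psd_dominated] uses it. *)
Fixpoint in_span (es : seq U) x : Prop :=
  if es is e :: es' then exists c, in_span es' (x - c *: e) else x = 0.

(** Induction on the generators, for all pairs of forms at once. A generator e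
    with b e e = 0 is null for both forms and can be dropped. For the other
    ones, the forms are replaced by their restrictions to the b-orthogonal
    complement of e, and the component along e contributes the ratio of s e e to
    b e e to the constant. *)
Lemma psd_dominated b s es : psd_form b -> psd_form s ->
  (forall x, b x x = 0 -> s x x = 0) ->
  exists2 K, 0 < K & forall x, in_span es x -> s x x <= K * b x x.
Proof.
elim: es b s => [|e es IH] b s bP sP ker /=.
  by exists 1 => // x ->; rewrite !psd_0l// mulr0.
have [be0|be0] := eqVneq (b e e) 0.
  have [K K0 Kle] := IH b s bP sP ker; exists K => // x [c /Kle].
  have se0 := ker e be0; rewrite -scaleNr !psd_sqD// be0 se0.
  rewrite (psd_sym x e bP) (psd_sym x e sP).
  by rewrite (psd_null x bP be0) (psd_null x sP se0) !(mulr0, addr0).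
have be : 0 < b e e by rewrite lt_neqAle eq_sym be0 psd_ge0.
have lin := @deflate_lin b e _ _ _ bP.
have [||x /ker//|K K0 Kle] := IH (fun x y => b (deflate b e x) (deflate b e y))
    (fun x y => s (deflate b e x) (deflate b e y)).
- exact: psd_comp.
- exact: psd_comp.
pose r := s e e / b e e.
have r0 : 0 <= r by rewrite divr_ge0 ?psd_ge0.
exists (2 * K + 2 * r); first by lra.
move=> x [c /Kle].
have -> : deflate b e (x - c *: e) = deflate b e x.
  by rewrite addrC -scaleNr lin deflate_self// scaler0 add0r.
set y := deflate b e x => sy.
have xE : x = y + (b x e / b e e) *: e by rewrite /y /deflate subrK.
have bx := deflate_norm x bP be0.
have yy := psd_ge0 y bP.
have sx : s x x <= 2 * s y y + 2 * (r * (b x e ^+ 2 / b e e)).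
  rewrite {1 2}xE (le_trans (psd_le2 _ _ sP))// lerD2l.
  rewrite !(psd_Zl, psd_Zr)// /r.
  by rewrite le_eqVlt; apply/orP; left; apply/eqP; field.
have sq : 0 <= b x e ^+ 2 / b e e by rewrite divr_ge0 ?sqr_ge0 ?ltW.
rewrite bx -/y; set t := b x e ^+ 2 / b e e in sx sq *.
have : 0 <= r * b y y by rewrite mulr_ge0.
have : 0 <= K * t by rewrite mulr_ge0// ltW.
by nra.
Qed.

(** Let mu be the largest number such that b = a - mu s is positive semidefinite.
    If every null vector of b were null for s, then s <= K b by [psd_dominated],
    and mu could be increased by 1 / K. So b has a null vector f with s f f > 0,
    and f is an eigenvector by [psd_null]. The form s may be degenerate. *)
Lemma psd_pencil (a s : U -> U -> R) es Lam w :
  psd_form a -> psd_form s -> (forall x, in_span es x) ->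
  a w w < Lam * s w w ->
  exists mu f, [/\ mu < Lam, forall x, a f x = mu * s f x & 0 < s f f].
Proof.
move=> aP sP spanU aw.
have sw : 0 < s w w.
  rewrite lt_neqAle eq_sym psd_ge0// andbT; apply/negP => /eqP sw0.
  by move: aw; rewrite sw0 mulr0 ltNge psd_ge0.
pose A := [set mu | forall x, mu * s x x <= a x x].
have A0 : A 0 by move=> x; rewrite mul0r psd_ge0.
have Aub : ubound A (a w w / s w w).
  by move=> mu Amu; rewrite ler_pdivlMr.
have supA : has_sup A by split; [exists 0|exists (a w w / s w w)].
pose mu := sup A.
have muLam : mu < Lam.
  apply: le_lt_trans (_ : a w w / s w w < Lam); last by rewrite ltr_pdivrMr.
  by apply: ge_sup => //; exists 0.
have Amu : A mu.
  move=> x; have [->|sx] := eqVneq (s x x) 0; first by rewrite mulr0 psd_ge0.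
  have sx0 : 0 < s x x by rewrite lt_neqAle eq_sym sx psd_ge0.
  rewrite -ler_pdivlMr//; apply: ge_sup; first by exists 0.
  by move=> m Am; rewrite ler_pdivlMr.
pose b x y := a x y - mu * s x y.
have bP : psd_form b.
  split=> [x y|c x y z|x]; rewrite /b.
  - by rewrite psd_sym// (psd_sym x).
  - by rewrite !(psd_Dl, psd_Zl)//; ring.
  - by rewrite subr_ge0; exact: Amu.
have [[f bf sf]|noker] := pselect (exists2 f, b f f = 0 & s f f != 0).
  exists mu, f; split=> // [x|]; last by rewrite lt_neqAle eq_sym sf psd_ge0.
  by apply/eqP; rewrite -subr_eq0; apply/eqP; exact: (psd_null x bP bf).
have ker x : b x x = 0 -> s x x = 0.
  by move=> bx; apply/eqP/negPn/negP => sx; apply: noker; exists x.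
have [K K0 Kle] := psd_dominated es bP sP ker.
have : A (mu + K^-1).
  move=> x; have := Kle x (spanU x); rewrite /b -ler_pdivrMl//.
  by lra.
move/(ub_le_sup supA.2); rewrite -/mu => h.
have : 0 < K^-1 by rewrite invr_gt0.
lra.
Qed.

(** The Euler-Lagrange equation of a quadratic functional. *)
Lemma minimizer_eq q (l : U -> R) x : psd_form q ->
  (forall c y z, l (c *: y + z) = c * l y + l z) ->
  (forall y, q x x - 2 * l x <= q y y - 2 * l y) ->
  forall y, q x y = l y.
Proof.
move=> qP linl qmin y; apply/eqP; rewrite -subr_eq0; apply/negPn/negP => nz.
set g := q x y - l y in nz.
have Q0 := psd_ge0 y qP.
have g2 : 0 < g ^+ 2 by rewrite exprn_even_gt0.
(* The step - c y from x lowers the functional by c ^ 2 (q y y + 2); the added 1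
   covers the case q y y = 0. *)
pose c := g / (q y y + 1).
have gc : g = c * (q y y + 1) by rewrite /c; field; lra.
have := qmin (x + (- c) *: y).
rewrite psd_sqD// (addrC x) linl.
have -> : q x y = g + l y by rewrite /g subrK.
have c2 : 0 < c ^+ 2.
  by rewrite exprn_even_gt0//=; apply: contraNneq nz => c0; rewrite gc c0 mul0r.
rewrite gc; nra.
Qed.

(** Let pi x be the sum of the s x (phi j) *: phi j, and P x = x - pi x, so that
    Lam is multiplied by s (P w, P w). The forms a and s are block diagonal with respect to pi and P,
    so an eigenvector f of the pencil of a (P x, P y) and s (P x, P y) yields an
    eigenvector P f of the original pencil that is orthogonal to the phi_j.
    Completeness excludes those below Lam with s (P f, P f) > 0; hence
    Lam s (P w, P w) <= a (P w, P w) by [psd_pencil], and P does not increase a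
    since the lam_j are nonnegative. *)
Lemma spectral_gap (a s : U -> U -> R) es Lam m (lam : 'I_m -> R)
    (phi : 'I_m -> U) :
  psd_form a -> psd_form s -> (forall x, in_span es x) ->
  (forall i j, s (phi i) (phi j) = (i == j)%:R) ->
  (forall j x, a (phi j) x = lam j * s (phi j) x) ->
  (forall mu f, (forall x, a f x = mu * s f x) -> mu < Lam ->
    (forall j, s f (phi j) = 0) -> s f f = 0) ->
  forall w, Lam * (s w w - \sum_j s w (phi j) ^+ 2) <= a w w.
Proof.
move=> aP sP spanU ortho eig complete w.
pose P x := x - \sum_j s x (phi j) *: phi j.
have linP c x y : P (c *: x + y) = c *: P x + P y.
  rewrite /P scalerBr scaler_sumr addrACA -opprD -big_split/=.
  by congr (_ - _); apply: eq_bigr => j _; rewrite psd_Dl// psd_Zl// scalerDl scalerA.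
have sPphi x j : s (P x) (phi j) = 0.
  rewrite psd_Bl// psd_suml// (bigD1 j)//= big1 => [|k kj].
    by rewrite psd_Zl// ortho eqxx mulr1 addr0 subrr.
  by rewrite psd_Zl// ortho (negPf kj) mulr0.
have sphi j x : s (phi j) (P x) = 0 by rewrite psd_sym.
have aphi j x : a (phi j) (P x) = 0 by rewrite eig sphi mulr0.
have aPx x y : a (P x) y = a (P x) (P y).
  rewrite -{1}(subrK (\sum_j s y (phi j) *: phi j) y) -/(P y) psd_Dr//.
  rewrite [X in _ + X]psd_sym// psd_suml// big1 ?addr0// => j _.
  by rewrite psd_Zl// aphi mulr0.
have sPx x y : s (P x) y = s (P x) (P y).
  rewrite -{1}(subrK (\sum_j s y (phi j) *: phi j) y) -/(P y) psd_Dr//.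
  rewrite [X in _ + X]psd_sym// psd_suml// big1 ?addr0// => j _.
  by rewrite psd_Zl// sphi mulr0.
have sPw : s (P w) (P w) = s w w - \sum_j s w (phi j) ^+ 2.
  rewrite -sPx psd_Bl// psd_suml//; congr (_ - _); apply: eq_bigr => j _.
  by rewrite psd_Zl// (psd_sym (phi j)).
have lam0 j : 0 <= lam j.
  by have := psd_ge0 (phi j) aP; rewrite eig ortho eqxx mulr1.
have aPw : a (P w) (P w) <= a w w.
  rewrite -aPx psd_Bl// gerBl psd_suml//; apply: sumr_ge0 => j _.
  rewrite psd_Zl// eig (psd_sym (phi j))// mulrCA -expr2.
  by rewrite mulr_ge0// sqr_ge0.
rewrite -sPw; apply: le_trans aPw; rewrite leNgt; apply/negP => lt.
have aP' := psd_comp aP linP; have sP' := psd_comp sP linP.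
have [mu [f [muLam eigf sf]]] := psd_pencil aP' sP' spanU lt.
suff s0 : s (P f) (P f) = 0 by rewrite s0 ltxx in sf.
by apply: (complete mu) => // x; rewrite aPx sPx.
Qed.

(** The equations of the psi_ij, added up with weights alpha_ij u, give
    a (u0, e) + sum alpha (u0) alpha (e) = sum alpha (u) alpha (e) for
    e = u - u0, that is a (u0, e) = sum alpha (e) ^ 2. *)
Lemma coarse_projection (a : U -> U -> R) n (l : 'I_n -> nat)
    (alpha : forall i, 'I_(l i) -> U -> R) (psi : forall i, 'I_(l i) -> U) :
  psd_form a ->
  (forall i j c x y, alpha i j (c *: x + y) = c * alpha i j x + alpha i j y) ->
  (forall i j x,
     a (psi i j) (psi i j) + \sum_k \sum_h alpha k h (psi i j) ^+ 2
       - 2 * alpha i j (psi i j) <=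
     a x x + \sum_k \sum_h alpha k h x ^+ 2 - 2 * alpha i j x) ->
  forall u, let u0 := \sum_i \sum_j alpha i j u *: psi i j in
    a u0 u0 + a (u - u0) (u - u0) + 2 * (\sum_i \sum_j alpha i j (u - u0) ^+ 2)
    = a u u.
Proof.
move=> aP lin psimin u u0.
pose q x y := a x y + \sum_k \sum_h alpha k h x * alpha k h y.
have qP : psd_form q.
  apply: psd_add => //; apply: psd_sum => k; apply: psd_sum => h.
  by apply: psd_square; exact: lin.
have EL i j y : q (psi i j) y = alpha i j y.
  by apply: minimizer_eq => //; exact: psimin.
have qu0 y : q u0 y = \sum_i \sum_j alpha i j u * alpha i j y.
  rewrite psd_suml//; apply: eq_bigr => i _; rewrite psd_suml//.
  by apply: eq_bigr => j _; rewrite psd_Zl// EL.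
set e := u - u0.
have alphaB i j : alpha i j e = alpha i j u - alpha i j u0.
  by rewrite /e addrC -scaleN1r lin mulN1r addrC.
have ae : a u0 e = \sum_i \sum_j alpha i j e ^+ 2.
  move: (qu0 e); rewrite /q => /(canRL (addrK _)) ->.
  rewrite -sumrB; apply: eq_bigr => i _; rewrite -sumrB; apply: eq_bigr => j _.
  by rewrite -mulrBl -alphaB.
have := psd_sqD 1 e u0 aP; rewrite scale1r {1 2}/e subrK (psd_sym e)// ae => ->.
by ring.
Qed.

End psd_forms.

Section coordinates.
Context {R : realType}.

Lemma in_span_sum (U : lmodType R) I (r : seq I) (f : I -> U) (c : I -> R) :
  in_span [seq f i | i <- r] (\sum_(i <- r) c i *: f i).
Proof.
elim: r => [|i r IH] /=; first by rewrite big_nil.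
by exists (c i); rewrite big_cons addrC addrA addNr add0r.
Qed.

Lemma in_span_rV n (x : 'rV[R]_n) :
  in_span [seq delta_mx ord0 i | i <- index_enum 'I_n] x.
Proof. by rewrite [x in in_span _ x]row_sum_delta; exact: in_span_sum. Qed.

(** Finitely many linear functionals that separate the points of V make it finite
    dimensional: a functional that does not vanish on V costs one generator,
    and it remains to generate its kernel. *)
Lemma finite_generation (U : lmodType R) (V : set U) (I : eqType) (r : seq I)
    (ev : I -> U -> R) :
  V 0 -> (forall c x y, V x -> V y -> V (c *: x + y)) ->
  (forall i c x y, ev i (c *: x + y) = c * ev i x + ev i y) ->
  (forall x, V x -> (forall i, i \in r -> ev i x = 0) -> x = 0) ->
  exists2 es : seq U, forall i, V es`_i & forall x, V x -> in_span es x.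
Proof.
move=> V0 Vlin evlin; elim: r V V0 Vlin => [|i r IH] V V0 Vlin inj.
  by exists [::] => [i|x /inj]; [rewrite nth_nil|exact].
have f0 : ev i 0 = 0.
  by have := evlin i (-1) 0 0; rewrite scaler0 addr0 mulN1r addNr.
have [] := IH (V `&` [set x | ev i x = 0]).
- by [].
- move=> c x y [Vx /= fx] [Vy /= fy]; split; first exact: Vlin.
  by rewrite /= evlin fx fy mulr0 addr0.
- move=> x [Vx fx] h; apply: inj => // j; rewrite inE => /predU1P[->//|].
  exact: h.
move=> es Ves span.
have [[e [Ve fe]]|none] := pselect (exists e, V e /\ ev i e <> 0); last first.
  exists es => [j|x Vx]; first exact: (Ves j).1.
  by apply: span; split=> //=; apply: contrapT => fx; apply: none; exists x.
exists (e :: es) => [[|j]//|x Vx /=]; first exact: (Ves j).1.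
exists (ev i x / ev i e); apply: span; rewrite addrC -scaleNr.
split; first exact: Vlin.
by rewrite /= evlin mulNr divfK ?addNr//; exact/eqP.
Qed.

Lemma in_span_coord (U : lmodType R) (es : seq U) x : in_span es x ->
  exists c : 'rV[R]_(size es), x = \sum_(i < size es) c ord0 i *: es`_i.
Proof.
suff: in_span es x ->
    exists c : nat -> R, x = \sum_(i < size es) c i *: es`_i.
  move=> h /h[c ->]; exists (\row_i c i).
  by apply: eq_bigr => i _; rewrite mxE.
elim: es x => [|e es IH] x /=; first by move=> ->; exists (fun=> 0); rewrite big_ord0.
case=> c /IH[d dE]; exists (fun i => if i is j.+1 then d j else c).
by rewrite big_ord_recl/= -dE addrC subrK.
Qed.

End coordinates.

(** * Barycentric coordinates *)

Section simplex.
Context {R : realType} {d : nat}.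
Notation E := 'rV[R]_d.
Implicit Types (v : 'I_d.+1 -> E) (x y : E) (f g : E -> R).

Lemma dotDr (a x y : E) : dot a (x + y) = dot a x + dot a y.
Proof.
by rewrite /dot -big_split; apply: eq_bigr => i _; rewrite mxE mulrDr.
Qed.

Lemma dotZr (a x : E) c : dot a (c *: x) = c * dot a x.
Proof.
by rewrite /dot mulr_sumr; apply: eq_bigr => i _; rewrite mxE mulrCA.
Qed.

Lemma dotC (a x : E) : dot a x = dot x a.
Proof. by apply: eq_bigr => i _; rewrite mulrC. Qed.

Lemma dotDl (a x y : E) : dot (x + y) a = dot x a + dot y a.
Proof. by rewrite dotC dotDr !(dotC a). Qed.

Lemma dotZl (a x : E) c : dot (c *: x) a = c * dot x a.
Proof. by rewrite dotC dotZr dotC. Qed.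

Lemma dot_ge0 x : 0 <= dot x x.
Proof. by apply: sumr_ge0 => i _; rewrite -expr2 sqr_ge0. Qed.

Lemma dot_delta x i : dot x (delta_mx ord0 i) = x ord0 i.
Proof.
rewrite /dot (bigD1 i)//= big1 ?addr0 ?mxE ?eqxx ?mulr1// => j ji.
by rewrite mxE (negPf ji) andbF mulr0.
Qed.

Lemma dot_sumr (I : finType) (a : E) (c : I -> R) (w : I -> E) :
  dot a (\sum_i c i *: w i) = \sum_i c i * dot a (w i).
Proof.
elim/big_rec2: _ => [|i _ x _ <-]; last by rewrite dotDr dotZr.
by rewrite /dot big1// => i _; rewrite mxE mulr0.
Qed.

Lemma dot_suml (I : finType) (a : I -> E) x :
  dot (\sum_i a i) x = \sum_i dot (a i) x.
Proof.
elim/big_rec2: _ => [|i _ y _ <-]; last by rewrite dotDl.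
by rewrite /dot big1// => i _; rewrite mxE mul0r.
Qed.

Lemma affine_comb (a : E) (b : R) (c : 'I_d.+1 -> R) v : \sum_j c j = 1 ->
  dot a (\sum_j c j *: v j) + b = \sum_j c j * (dot a (v j) + b).
Proof.
move=> c1; rewrite dot_sumr -[in LHS](mul1r b) -c1 mulr_suml -big_split/=.
by apply: eq_bigr => j _; rewrite mulrDr.
Qed.

Definition edge_mx v : 'M[R]_d := \matrix_(j < d) (v (lift ord0 j) - v ord0).

(** The coordinates of index lift ord0 k are those of x - v ord0 on the edges;
    the one of index ord0 makes the sum 1. *)
Definition bary v (j : 'I_d.+1) x : R :=
  let y := (x - v ord0) *m invmx (edge_mx v) in
  if unlift ord0 j is Some k then y ord0 k else 1 - \sum_k y ord0 k.

Lemma bary_ord0 v x : bary v ord0 x =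
  1 - \sum_k ((x - v ord0) *m invmx (edge_mx v)) ord0 k.
Proof. by rewrite /bary unlift_none. Qed.

Lemma bary_lift v k x : bary v (lift ord0 k) x =
  ((x - v ord0) *m invmx (edge_mx v)) ord0 k.
Proof. by rewrite /bary liftK. Qed.

Lemma bary_sum v x : \sum_j bary v j x = 1.
Proof.
by rewrite big_ord_recl bary_ord0 (eq_bigr _ (fun k _ => bary_lift v k x)) subrK.
Qed.

Lemma edge_mx_unit v : affinely_independent v -> edge_mx v \in unitmx.
Proof. by rewrite -row_free_unit. Qed.

Lemma comb_edge v (c : 'I_d.+1 -> R) : \sum_j c j = 1 ->
  \sum_j c j *: v j - v ord0 = (\row_k c (lift ord0 k)) *m edge_mx v.
Proof.
move=> c1; rewrite -[in LHS](scale1r (v ord0)) -c1 scaler_suml -sumrB.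
rewrite big_ord_recl subrr add0r mulmx_sum_row; apply: eq_bigr => k _.
by rewrite rowK !mxE scalerBr.
Qed.

Lemma bary_unique v (c : 'I_d.+1 -> R) k : affinely_independent v ->
  \sum_j c j = 1 -> bary v k (\sum_j c j *: v j) = c k.
Proof.
move=> iv c1; have [j ->|->] := unliftP ord0 k; rewrite ?bary_lift ?bary_ord0;
  rewrite comb_edge// mulmxK ?edge_mx_unit//; first by rewrite mxE.
rewrite -c1 big_ord_recl; apply/eqP; rewrite subr_eq; apply/eqP; congr (_ + _).
by apply: eq_bigr => j _; rewrite mxE.
Qed.

Lemma bary_vtx v j k : affinely_independent v -> bary v k (v j) = (k == j)%:R.
Proof.
move=> iv; have c1 : \sum_i (i == j)%:R = 1 :> R.
  by rewrite (bigD1 j)//= eqxx big1 ?addr0// => i /negPf ->.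
rewrite -(bary_unique k iv c1); congr (bary _ _ _).
rewrite (bigD1 j)//= eqxx scale1r big1 ?addr0// => i /negPf ->.
by rewrite scale0r.
Qed.

Lemma bary_comb v x : affinely_independent v -> x = \sum_j bary v j x *: v j.
Proof.
move=> iv; apply: (addIr (- v ord0)); rewrite comb_edge ?bary_sum//.
rewrite -[LHS](mulmxKV (edge_mx_unit iv)); congr (_ *m _).
by apply/rowP => k; rewrite [RHS]mxE bary_lift.
Qed.

Lemma bary_affine v j : exists (a : E) b, forall x, bary v j x = dot a x + b.
Proof.
set N := invmx (edge_mx v).
have aff k : exists (a : E) b, forall x,
    ((x - v ord0) *m N) ord0 k = dot a x + b.
  exists (\row_i N i k), (- (v ord0 *m N) ord0 k) => x.
  rewrite mulmxBl mxE [in RHS]dotC; congr (_ + _); last by rewrite mxE.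
  by rewrite mxE; apply: eq_bigr => i _; rewrite mxE.
rewrite /bary; case: unliftP => [k _|_]; first exact: aff.
have [a aE] := choice aff; have [b bE] := choice aE.
exists (-1 *: \sum_k a k), (1 - \sum_k b k) => x.
under eq_bigr do rewrite bE.
by rewrite dotZl dot_suml big_split/=; ring.
Qed.

Lemma affine_bary (a : E) b f v x : affinely_independent v ->
  (forall j, f (v j) = dot a (v j) + b) ->
  dot a x + b = \sum_j bary v j x * f (v j).
Proof.
move=> iv fE; rewrite {1}(bary_comb x iv) affine_comb ?bary_sum//.
by apply: eq_bigr => j _; rewrite fE.
Qed.

Lemma faceP v (J : {set 'I_d.+1}) x : affinely_independent v ->
  face v J x <-> (forall j, 0 <= bary v j x) /\
                 (forall j, j \notin J -> bary v j x = 0).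
Proof.
move=> iv; split=> [[c [c0 cJ c1 ->]]|[x0 xJ]].
  by split=> j; rewrite bary_unique//; exact: cJ.
by exists (bary v ^~ x); split=> //; [exact: bary_sum|exact: bary_comb].
Qed.

Lemma simplexP v x : affinely_independent v ->
  face v [set: 'I_d.+1]%SET x <-> (forall j, 0 <= bary v j x).
Proof.
move=> iv; rewrite faceP//; split=> [[]//|x0]; split=> // j.
by rewrite finset.in_setT.
Qed.

Lemma affine_continuous (a : E) b : continuous (fun x => dot a x + b).
Proof.
move=> x; apply: (@continuousD R R^o E (dot a) (cst b) x); last exact: cst_continuous.
apply: (@continuous_big R^o _ +%R 0 xpredT); first exact: add_continuous.
move=> i _ y; apply: (@continuousM R E (cst (a ord0 i)) (fun z : E => z ord0 i)).
  exact: cst_continuous.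
exact: coord_continuous.
Qed.

Lemma bary_continuous v j : continuous (bary v j).
Proof.
have [a [b E]] := bary_affine v j.
by rewrite (_ : bary v j = fun x => dot a x + b); [exact: affine_continuous|apply/funext].
Qed.

Lemma simplex_closed v : affinely_independent v ->
  closed (face v [set: 'I_d.+1]%SET).
Proof.
move=> iv.
rewrite (_ : face v _ = \bigcap_(j in [set: 'I_d.+1]) bary v j @^-1` [set c | 0 <= c]).
  apply: closed_bigI => j _; apply: closed_comp; last exact: closed_ge.
  by move=> x _; exact: bary_continuous.
apply/seteqP; split=> x; first by move/(simplexP _ iv) => h j _; exact: h.
by move=> h; apply/(simplexP _ iv) => j; exact: h.
Qed.

Lemma open_simplex_open v : open [set x | forall j, 0 < bary v j x].
Proof.
rewrite openE => x xpos.
apply: (@filter_forall _ _ (fun j => [set y | 0 < bary v j y]) (nbhs x)) => j.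
apply: (@bary_continuous v j x [set c | 0 < c]).
by apply: open_nbhs_nbhs; split; [exact: open_gt|exact: xpos].
Qed.

(** If d > 0, moving from x in the direction v k - v j, for some k != j, lowers
    the coordinate j at unit speed and keeps an interior point inside the simplex
    for a while, so that this coordinate cannot be 0. *)
Lemma interior_simplexP v x : (0 < d)%N -> affinely_independent v ->
  (face v [set: 'I_d.+1]%SET)° x <-> (forall j, 0 < bary v j x).
Proof.
move=> d0 iv; split=> [xi j|xpos]; last first.
  have op := @open_simplex_open v.
  suff : [set x | forall j, 0 < bary v j x] `<=` (face v [set: 'I_d.+1]%SET)°.
    by apply.
  by rewrite -open_subsetE// => y ypos; apply/simplexP => // j; exact: ltW.
have [k kj] : exists k : 'I_d.+1, k != j.
  apply: contrapT => h; have h' (k : 'I_d.+1) : k = j.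
    by apply/eqP/negPn/negP => kj; apply: h; exists k.
  by have := congr1 val (etrans (h' ord0) (esym (h' ord_max))) => /= /eqP; rewrite eq_sym -leqn0 leqNgt d0.
have [a [b aE]] := bary_affine v j.
pose w := v k - v j.
have cw : continuous (fun h : R => x + h *: w).
  move=> h; apply: (@continuousD R E R^o (cst x) (fun h : R => h *: w) h).
    exact: cst_continuous.
  by apply: continuousZr_tmp => A.
have : \forall h \near (0 : R), face v [set: 'I_d.+1]%SET (x + h *: w).
  by apply: (cw 0); rewrite scale0r addr0.
case/nbhs_ballP => e /= e0 ballP.
have h2 : ball (0 : R) e (e / 2).
  by rewrite /ball/= sub0r normrN gtr0_norm ?divr_gt0// ltr_pdivrMr// ltr_pMr// ltr1n.
have := (simplexP _ iv).1 (ballP _ h2) j.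
rewrite aE dotDr dotZr addrAC -aE.
have -> : dot a w = -1.
  have := bary_vtx j j iv; have := bary_vtx k j iv; rewrite !aE eqxx.
  rewrite (eq_sym j) (negPf kj) (_ : w = v k + (-1) *: v j); last by rewrite scaleN1r.
  by rewrite dotDr dotZr /=; lra.
have : 0 < e by []. lra.
Qed.

End simplex.

(** * Integration of bounded functions *)

Section integration.
Context {R : realType} {d : nat}.
Notation E := 'rV[R]_d.
Notation pt := (@point_of R d).
Implicit Types (T : set E) (f g : E -> R) (v : 'I_d.+1 -> E).

Definition finite_volume T : Prop :=
  measurable (pt @^-1` T) /\ (leb d (pt @^-1` T) < +oo)%E.

(** A class of integrable functions that is closed under sums and products and
    contains all the integrands below. *)
Definition tame T f : Prop :=
  measurable_fun (pt @^-1` T) (f \o pt) /\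
  exists M, forall x, T x -> `|f x| <= M.

Lemma measurable_affine (a : E) b :
  measurable_fun [set: d.-tuple (measurableTypeR R)] (fun t => dot a (pt t) + b).
Proof.
apply: measurable_funD; last exact: measurable_cst.
rewrite /dot; apply: measurable_sum => i; apply: measurable_funM.
  exact: measurable_cst.
under eq_fun do rewrite mxE.
exact: measurable_tnth.
Qed.

Lemma measurable_halfspace (a : E) b (I : interval R) :
  measurable (pt @^-1` [set x | dot a x + b \in I]).
Proof.
rewrite -[X in measurable X]setTI.
exact: (measurable_affine a b measurableT (measurable_itv I)).
Qed.

Lemma measurable_forall n (P : 'I_n -> set E) :
  (forall i, measurable (pt @^-1` P i)) ->
  measurable (pt @^-1` [set x | forall i, P i x]).
Proof.
move=> mP; rewrite (_ : _ @^-1` _ = \bigcap_(i in [set: 'I_n]) (pt @^-1` P i)).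
  by apply: fin_bigcap_measurable => // i _; exact: mP.
by apply/seteqP; split=> t h i => [_|]; exact: h.
Qed.

Lemma measurable_bary v j (I : interval R) :
  measurable (pt @^-1` [set x | bary v j x \in I]).
Proof.
have [a [b aE]] := bary_affine v j.
rewrite (_ : [set x | _] = [set x | dot a x + b \in I]).
  exact: measurable_halfspace.
by apply/seteqP; split=> x /=; rewrite aE.
Qed.

Lemma measurable_face v J : affinely_independent v ->
  measurable (pt @^-1` face v J).
Proof.
move=> iv; pose I (j : 'I_d.+1) : interval R :=
  if j \in J then `[0, +oo[ else `[0, 0].
rewrite (_ : face v J = [set x | forall j, bary v j x \in I j]).
  by apply: measurable_forall => j; exact: measurable_bary.
apply/seteqP; split=> x; rewrite faceP//= /I.
  move=> [x0 xJ] j; case: ifPn => jJ; rewrite in_itv/= ?andbT//.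
  by rewrite xJ// lexx.
move=> h; split=> j; first by move: (h j); case: ifP => _; rewrite in_itv/= => /andP[].
by move=> jJ; have := h j; rewrite (negPf jJ) in_itv/= => /andP[? ?]; apply/eqP; rewrite eq_le; apply/andP.
Qed.

Lemma affine_bounded v (a : E) b : affinely_independent v ->
  exists M, forall x, face v [set: 'I_d.+1]%SET x -> `|dot a x + b| <= M.
Proof.
move=> iv; exists (\sum_j `|dot a (v j) + b|) => x /(simplexP _ iv) x0.
rewrite (@affine_bary _ _ a b (fun x => dot a x + b) v x)//.
apply: (le_trans (ler_norm_sum _ _ _)); apply: ler_sum => j _.
rewrite normrM ler_piMl// ger0_norm//.
rewrite -(bary_sum v x) (bigD1 j)//= lerDl; exact: sumr_ge0.
Qed.

(** The cartesian coordinates are affine, hence bounded on the simplex, which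
    therefore lies in a box. *)
Lemma finite_volume_simplex v : (0 < d)%N -> affinely_independent v ->
  finite_volume (face v [set: 'I_d.+1]%SET)°.
Proof.
move=> d0 iv.
have mT : measurable (pt @^-1` (face v [set: 'I_d.+1]%SET)°).
  rewrite (_ : _° = [set x | forall j, bary v j x \in `]0, +oo[]).
    by apply: measurable_forall => j; exact: measurable_bary.
  apply/seteqP; split=> x => [/(interior_simplexP _ d0 iv) h j|h].
    by rewrite in_itv/= andbT.
  apply/(interior_simplexP _ d0 iv) => j.
  by have := h j; rewrite in_itv/= andbT.
split=> //.
have [M MP] := choice (fun i => affine_bounded (delta_mx ord0 i) 0 iv).
pose B := [set t : d.-tuple (measurableTypeR R) |
  forall i, tnth t i \in `[- M i, M i]].
have mB : measurable B.
  rewrite (_ : B = pt @^-1` [set x | forall i, dot (delta_mx ord0 i) x + 0 \in `[- M i, M i]]).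
    by apply: measurable_forall => i; exact: measurable_halfspace.
  by apply/seteqP; split=> t h i; have := h i; rewrite /= addr0 dotC dot_delta mxE.
apply: (@le_lt_trans _ _ (leb d B)).
  apply: le_measure; rewrite ?inE// => t /interior_subset h i.
  have := MP i _ h; rewrite addr0 dotC dot_delta mxE in_itv/= ler_norml.
  by [].
rewrite leb_box ltey_eq; apply/orP; left; elim/big_rec: _ => //= i x _ xf.
by rewrite fin_numM// lebesgue_measure_itv/=; case: ifP.
Qed.

Section finite_volume.
Variable T : set E.
Hypothesis fT : finite_volume T.

Lemma tame_cst c : tame T (cst c).
Proof. by split; [exact: measurable_cst|exists `|c|]. Qed.

Lemma tameD f g : tame T f -> tame T g -> tame T (fun x => f x + g x).
Proof.
move=> [mf [M fM]] [mg [N gN]]; split; first exact: measurable_funD.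
by exists (M + N) => x Tx; rewrite (le_trans (ler_normD _ _))// lerD ?fM ?gN.
Qed.

Lemma tameM f g : tame T f -> tame T g -> tame T (fun x => f x * g x).
Proof.
move=> [mf [M fM]] [mg [N gN]]; split; first exact: measurable_funM.
by exists (M * N) => x Tx; rewrite normrM ler_pM ?fM ?gN.
Qed.

Lemma tame_sqr f : tame T f -> tame T (fun x => f x ^+ 2).
Proof. by move=> tf; under eq_fun do rewrite expr2; exact: tameM. Qed.

Lemma eq_tame f g : {in T, f =1 g} -> tame T f -> tame T g.
Proof.
move=> fg [mf [M fM]]; split.
  apply: eq_measurable_fun mf => t; rewrite inE => /mem_set; exact: fg.
by exists M => x Tx; rewrite -fg ?inE//; exact: fM.
Qed.

Lemma tame_integrable f : tame T f ->
  (leb d).-integrable (pt @^-1` T) (EFin \o (f \o pt)).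
Proof.
case: fT => mT finT [mf [M fM]]; apply: measurable_bounded_integrable => //.
exists M; split; first exact: num_real.
by move=> x Mx t Tt; apply: le_trans (ltW Mx); exact: fM.
Qed.

Lemma intD f g : tame T f -> tame T g ->
  lebesgue_int T (fun x => f x + g x) = lebesgue_int T f + lebesgue_int T g.
Proof. by move=> tf tg; apply: RintegralD; [exact: fT.1|exact: tame_integrable..]. Qed.

Lemma intZ c f : tame T f ->
  lebesgue_int T (fun x => c * f x) = c * lebesgue_int T f.
Proof. by move=> tf; apply: RintegralZl; [exact: fT.1|exact: tame_integrable]. Qed.

Lemma eq_int f g : {in T, f =1 g} -> lebesgue_int T f = lebesgue_int T g.
Proof. by move=> fg; apply: eq_Rintegral => t; rewrite inE => /mem_set/fg. Qed.

Lemma int_ge0 f : (forall x, T x -> 0 <= f x) -> 0 <= lebesgue_int T f.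
Proof. by move=> f0; apply: Rintegral_ge0 => t; exact: f0. Qed.

Lemma le_int f g : tame T f -> tame T g -> (forall x, T x -> f x <= g x) ->
  lebesgue_int T f <= lebesgue_int T g.
Proof.
move=> tf tg fg; apply: le_Rintegral; [exact: fT.1|exact: tame_integrable..|].
by move=> t; exact: fg.
Qed.

Lemma int_sum (I : Type) (r : seq I) (P : pred I) (f : I -> E -> R) :
  (forall i, tame T (f i)) ->
  tame T (fun x => \sum_(i <- r | P i) f i x) /\
  lebesgue_int T (fun x => \sum_(i <- r | P i) f i x) =
  \sum_(i <- r | P i) lebesgue_int T (f i).
Proof.
move=> tf; elim: r => [|i r [IHt IH]].
  under eq_fun do rewrite big_nil.
  rewrite big_nil; split; first exact: tame_cst.
  have -> : (fun _ : E => 0 : R) = (fun x => 0 * cst 0 x).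
    by apply/funext => x; rewrite mul0r.
  by rewrite intZ ?mul0r//; exact: tame_cst.
under eq_fun do rewrite big_cons.
by rewrite big_cons; case: (P i) => //; split; [exact: tameD|rewrite intD// IH].
Qed.

End finite_volume.

Lemma int_cover (I : choiceType) (s : seq I) (T : I -> set E) f : uniq s ->
  (forall i, finite_volume (T i)) ->
  (forall i j, T i `&` T j !=set0 -> i = j) ->
  (forall i, i \in s -> tame (T i) f) ->
  lebesgue_int (\bigcup_(i in [set` s]) T i) f =
  \sum_(i <- s) lebesgue_int (T i) f.
Proof.
move=> us fT dT tf.
rewrite bigcup_seq; set U := fun s => \big[setU/set0]_(i <- s) T i.
suff [] : [/\ finite_volume (U s), tame (U s) f &
  lebesgue_int (U s) f = \sum_(i <- s) lebesgue_int (T i) f] by [].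
elim: s us tf => [_ _|i s IH /= /andP[iNs us] tf].
  rewrite /U !big_nil; split.
  - by split; rewrite preimage_set0 ?measure0.
  - by split; [rewrite preimage_set0; exact: measurable_fun_set0|exists 0].
  - by rewrite /lebesgue_int preimage_set0 Rintegral_set0.
have [|fU tU sE] := IH us; first by move=> j js; apply: tf; rewrite inE js orbT.
rewrite /U !big_cons -/(U s).
have tfi : tame (T i) f by apply: tf; rewrite mem_head.
have [mT finT] := fT i; have [mU finU] := fU.
have fV : finite_volume (T i `|` U s).
  split; rewrite preimage_setU; first exact: measurableU.
  by apply: le_lt_trans (measureU2 _ _ _) _ => //; rewrite lte_add_pinfty.
have tV : tame (T i `|` U s) f.
  split.
    by rewrite preimage_setU; apply/measurable_funU => //; split; [exact: tfi.1|exact: tU.1].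
  have [M fM] := tfi.2; have [N fN] := tU.2.
  by exists (Num.max M N) => x [/fM|/fN] fx; rewrite le_max fx ?orbT.
split=> //; rewrite -sE /lebesgue_int preimage_setU; apply: Rintegral_setU => //.
  by rewrite -preimage_setU; exact: tame_integrable.
apply/disj_setPS => t [/= Tt]; rewrite /U -bigcup_seq => -[j /= js Tj].
by move: iNs; rewrite (dT i j) ?js//; exists (pt t).
Qed.

End integration.

(** * Gradients of affine functions and their products *)

Section gradient.
Context {R : realType} {d : nat}.
Notation E := 'rV[R]_d.
Implicit Types (f g : E -> R) (x : E) (a : E) (b : R).

Lemma eq_grad f g x : (\forall y \near x, f y = g y) -> grad f x = grad g x.
Proof. by move=> fg; apply/rowP => i; rewrite !mxE; exact: near_eq_derive. Qed.

(** The difference quotient is an affine function of the step. *)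
Lemma grad_affineM a b a' b' x :
  grad (fun y => (dot a y + b) * (dot a' y + b')) x =
  (dot a x + b) *: a' + (dot a' x + b') *: a.
Proof.
apply/rowP => i; rewrite !mxE; set v := delta_mx _ _.
set p := dot a x + b; set q := dot a' x + b'.
rewrite -(dot_delta a) -(dot_delta a') -/v.
apply: cvg_lim => //.
have : (p * dot a' v + q * dot a v) + h * (dot a v * dot a' v) @[h --> (0 : R)^'] -->
    (p * dot a' v + q * dot a v) + 0 * (dot a v * dot a' v).
  apply: cvgD; first exact: cvg_cst.
  apply: cvgM; last exact: cvg_cst.
  exact: nbhs_dnbhs.
rewrite mul0r addr0; apply: cvg_trans; apply: near_eq_cvg.
near=> h.
have h0 : h != 0 by near: h; exact: nbhs_dnbhs_neq.
rewrite /= [LHS](_ : _ = (p * dot a' v + q * dot a v) + h * (dot a v * dot a' v))//.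
rewrite /= !dotDr !dotZr /p /q -[_ *: _]/(_ * _); field.
Unshelve. all: by end_near. Qed.

Lemma grad_affine a b x : grad (fun y => dot a y + b) x = a.
Proof.
have := grad_affineM a b 0 1 x.
have d0 y : dot (0 : E) y = 0 by rewrite /dot big1// => i _; rewrite mxE mul0r.
rewrite scaler0 add0r d0 add0r scale1r => {2}<-; congr (grad _ _).
by apply/funext => y; rewrite d0 add0r mulr1.
Qed.

End gradient.

(** * Cells of a conforming triangulation and energies *)

Section mesh.
Context {R : realType} {d : nat} (D : schwarz_data R d).
Notation E := 'rV[R]_d.
Implicit Types (t : mesh D) (f g v w : E -> R) (x : E) (S : {set mesh D}).
Hypothesis d_gt0 : (0 < d)%N.
Hypothesis polyD : polyhedral_domain D.
Hypothesis meshD : conforming_triangulation D.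

Local Notation lam t := (bary (vtx D t)).

Lemma vtx_indep t : affinely_independent (vtx D t).
Proof. by case: meshD. Qed.
Local Hint Resolve vtx_indep : core.

Lemma cellP t x : cell t x <-> forall j, 0 <= lam t j x.
Proof. exact: simplexP. Qed.

Lemma open_cellP t x : (cell t)° x <-> forall j, 0 < lam t j x.
Proof. exact: interior_simplexP. Qed.

Lemma vtx_cell t j : cell t (vtx D t j).
Proof. by apply/cellP => k; rewrite bary_vtx// ler0n. Qed.

Lemma cell_closed t : closed (cell t).
Proof. exact: simplex_closed. Qed.

Lemma closure_omegaP x : closure (omega D) x <-> exists t, cell t x.
Proof.
case: meshD => _ _ _ -> _.
by split=> [[t _ tx]|[t tx]]; exists t.
Qed.

Lemma affine_on_bary t f x : affine_on t f -> cell t x ->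
  f x = \sum_j lam t j x * f (vtx D t j).
Proof.
move=> [a [b fE]] tx; rewrite fE//; apply: affine_bary => // j.
by rewrite fE//; exact: vtx_cell.
Qed.

(** A point in an open cell has no zero barycentric coordinate, whereas
    conformity puts its common points with another cell on a proper face. *)
Lemma open_cell_face t t' (J : {set 'I_d.+1}) x :
  (cell t)° x -> face (vtx D t') J x -> t' = t /\ J = [set: 'I_d.+1]%SET.
Proof.
move=> tx xJ; case: (meshD) => _ inj inter _ _.
have t'x : cell t' x by apply/cellP; exact: ((faceP _ _ (vtx_indep t')).1 xJ).1.
have full (s : mesh D) (I : {set 'I_d.+1}) : (cell s)° x -> face (vtx D s) I x ->
    I = [set: 'I_d.+1]%SET.
  move=> /open_cellP pos /(faceP _ _ (vtx_indep s))[_ zero].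
  apply/setP => j; rewrite finset.in_setT; apply/negPn/negP => /zero j0.
  by have := pos j; rewrite j0 ltxx.
have tt' : t = t'.
  by apply/inj/full; [exact: tx|apply: inter; split=> //; exact: interior_subset].
by split=> //; apply: full xJ; rewrite -tt'.
Qed.

Lemma open_cell_disjoint t t' : (cell t)° `&` (cell t')° !=set0 -> t = t'.
Proof.
by move=> [x [tx /interior_subset t'x]]; have [] := open_cell_face tx t'x.
Qed.

Lemma interior_omega : (omega D)° = omega D.
Proof. by case: polyD => oo _ _; apply/interior_id. Qed.

(** Otherwise the point would be on the frontier, and so on a proper face of some
    cell. *)
Lemma open_cell_omega t x : (cell t)° x -> omega D x.
Proof.
move=> tx; apply: contrapT => nx; case: (polyD) => oo _ _.
case: (meshD) => _ _ _ cl /(_ x)[].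
  split; last by rewrite interior_omega.
  by apply/closure_omegaP; exists t; exact: interior_subset.
by move=> t' [J [/negP JT xJ _]]; have [_ /eqP] := open_cell_face tx xJ.
Qed.

Definition barycenter t : E := \sum_j (d.+1%:R^-1 : R) *: vtx D t j.

Lemma barycenter_in t : (cell t)° (barycenter t).
Proof.
apply/open_cellP => j; rewrite bary_unique// ?invr_gt0//.
by rewrite sumr_const card_ord -(mulr_natr _^-1) mulVf// pnatr_eq0.
Qed.

Lemma finite_volume_cell t : finite_volume (cell t)°.
Proof. exact: finite_volume_simplex. Qed.

Definition piecewise_affine f : Prop := forall t, affine_on t f.

Lemma near_cell t x (P : E -> Prop) : (cell t)° x ->
  (forall y, cell t y -> P y) -> \forall y \near x, P y.
Proof. by move=> tx cP; apply: filterS tx => y; exact: cP. Qed.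

Lemma grad_affine_on t f (a : E) b x : (forall y, cell t y -> f y = dot a y + b) ->
  (cell t)° x -> grad f x = a.
Proof.
move=> fE tx; rewrite -(grad_affine a b x); apply: eq_grad.
exact: near_cell tx _.
Qed.

Lemma tame_affine t f : affine_on t f -> tame (cell t)° f.
Proof.
move=> [a [b fE]].
apply: (@eq_tame _ _ _ (fun x => dot a x + b)).
  by move=> x; rewrite inE => /interior_subset /fE ->.
split; first exact: measurable_funTS (measurable_affine a b).
have [M MP] := affine_bounded a b (vtx_indep t).
by exists M => x /interior_subset; exact: MP.
Qed.

Lemma tame_grad t f g : affine_on t f -> affine_on t g ->
  tame (cell t)° (fun x => dot (grad f x) (grad g x)).
Proof.
move=> [a [b fE]] [a' [b' gE]]; apply: (@eq_tame _ _ _ (cst (dot a a'))).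
  by move=> x; rewrite inE => tx; rewrite (grad_affine_on fE) ?(grad_affine_on gE).
exact: tame_cst.
Qed.

(** The closure of omega is a finite union of cells, its frontier a finite union of
    faces. *)
Lemma measurable_omega : measurable (@point_of R d @^-1` omega D).
Proof.
case: (polyD) => oo _ _; case: (meshD) => _ _ _ cl fr.
pose B := [set p : mesh D * {set 'I_d.+1} |
  face (vtx D p.1) p.2 `<=` frontier (omega D)].
have mB : measurable (@point_of R d @^-1` \bigcup_(p in B) face (vtx D p.1) p.2).
  rewrite preimage_bigcup; apply: fin_bigcup_measurable => // p _.
  exact: measurable_face.
have mC : measurable (@point_of R d @^-1` closure (omega D)).
  rewrite cl preimage_bigcup; apply: fin_bigcup_measurable => // t _.
  exact: measurable_face.
rewrite (_ : omega D = closure (omega D) `\` \bigcup_(p in B) face (vtx D p.1) p.2).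
  exact: (measurableD mC mB).
apply/seteqP; split=> x.
  move=> ox; split; first exact: subset_closure.
  by move=> [p Bp /Bp[_]]; rewrite interior_omega.
move=> [cx nB]; apply: contrapT => nx; apply: nB.
have [|t [J [_ xJ sJ]]] := fr x; first by split=> //; rewrite interior_omega.
by exists (t, J).
Qed.

Section coefficient.
Variable C : R.
Hypothesis rhoD : admissible_coefficient D C.

Lemma rho_gt0 t x : (cell t)° x -> 0 < rho D x.
Proof. by case: rhoD => _ pos _ /open_cell_omega; exact: pos. Qed.

Lemma tame_rho t : tame (cell t)° (rho D).
Proof.
case: (rhoD) => brho _ rat; split.
  apply: measurable_funS brho; first exact: measurable_omega.
  by move=> x; exact: open_cell_omega.
exists (C * rho D (barycenter t)) => x tx; rewrite ger0_norm.
  by apply: (rat t) => //; exact: barycenter_in.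
exact/ltW/rho_gt0/tx.
Qed.

Lemma tame_energy t f g : affine_on t f -> affine_on t g ->
  tame (cell t)° (fun x => rho D x * dot (grad f x) (grad g x)).
Proof. by move=> af ag; apply: tameM; [exact: tame_rho|exact: tame_grad]. Qed.

Lemma open_cells_sum S f : (forall t, t \in S -> tame (cell t)° f) ->
  lebesgue_int (open_cells S) f = \sum_(t in S) lebesgue_int (cell t)° f.
Proof.
move=> tf; rewrite -[RHS]big_enum/= -int_cover ?enum_uniq//.
- congr (lebesgue_int _ f); apply/seteqP.
  by split=> x [t tS tx]; exists t => //; move: tS; rewrite /= mem_enum.
- exact: finite_volume_cell.
- exact: open_cell_disjoint.
- by move=> t; rewrite mem_enum; exact: tf.
Qed.

Lemma a_on_sum S f g : piecewise_affine f -> piecewise_affine g ->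
  a_on S f g = \sum_(t in S)
    lebesgue_int (cell t)° (fun x => rho D x * dot (grad f x) (grad g x)).
Proof. by move=> pf pg; apply: open_cells_sum => t _; exact: tame_energy. Qed.

Lemma a_form_split f g : piecewise_affine f -> piecewise_affine g ->
  a_form D f g = \sum_(i < nsub D) a_sub i f g.
Proof.
move=> pf pg; rewrite /a_form a_on_sum//.
rewrite (partition_big (dom D) xpredT)//=; apply: eq_bigr => i _.
rewrite /a_sub a_on_sum//; apply: eq_bigl => t.
by rewrite !inE.
Qed.

Lemma open_cells_region S x : open_cells S x -> region S x.
Proof. by move=> [t tS /interior_subset]; exists t. Qed.

Lemma eq_grad_region S f g x : (forall y, region S y -> f y = g y) ->
  open_cells S x -> grad f x = grad g x.
Proof.
move=> fg [t tS tx]; apply: eq_grad; apply: near_cell tx _ => y ty.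
by apply: fg; exists t.
Qed.

Lemma eq_a_on S f f' g g' : (forall y, region S y -> f y = f' y) ->
  (forall y, region S y -> g y = g' y) -> a_on S f g = a_on S f' g'.
Proof.
move=> ff' gg'; apply: eq_int => x; rewrite inE => Sx.
by rewrite (eq_grad_region ff' Sx) (eq_grad_region gg' Sx).
Qed.

Lemma eq_s_sub (i : 'I_(nsub D)) f f' g g' : (forall y, region (subdomain i) y -> f y = f' y) ->
  (forall y, region (subdomain i) y -> g y = g' y) -> s_sub i f g = s_sub i f' g'.
Proof.
move=> ff' gg'; apply: eq_int => x; rewrite inE => /open_cells_region Sx.
by rewrite ff' ?gg'.
Qed.

(** The forms are bilinear only on functions with integrable energy; composing
    them with a linear parametrization F by piecewise affine functions turns
    them into forms on a vector space. *)
Lemma a_on_psd S (U : lmodType R) (F : U -> E -> R) :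
  (forall c, piecewise_affine (F c)) ->
  (forall k c c' x, F (k *: c + c') x = k * F c x + F c' x) ->
  psd_form (fun c c' => a_on S (F c) (F c')).
Proof.
move=> pF lF.
rewrite (_ : (fun c c' => _) = fun c c' => \sum_(t in S) lebesgue_int (cell t)°
    (fun x => rho D x * dot (grad (F c) x) (grad (F c') x))); last first.
  by apply/funext => c; apply/funext => c'; exact: a_on_sum.
apply: psd_sum => t; split=> [c c'|k c c' e|c].
- by apply: eq_int => x _; rewrite dotC.
- have fv := finite_volume_cell t.
  have te h := tame_energy (pF h t) (pF e t).
  rewrite -(intZ fv)// -(intD fv)//; last exact: tameM (tame_cst _ k) (te c).
  apply: eq_int => x; rewrite inE => tx.
  have [a [b aE]] := pF c t; have [a' [b' aE']] := pF c' t.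
  have kE y : cell t y -> F (k *: c + c') y = dot (k *: a + a') y + (k * b + b').
    by move=> ty; rewrite lF aE// aE'// dotDl dotZl; ring.
  rewrite (grad_affine_on kE tx) (grad_affine_on aE tx) (grad_affine_on aE' tx).
  by rewrite dotDl dotZl; ring.
- apply: int_ge0 => x tx; rewrite mulr_ge0 ?dot_ge0//; exact/ltW/rho_gt0/tx.
Qed.

End coefficient.
End mesh.

(** * Nodal interpolation *)

Section interpolation.
Context {R : realType} {d : nat} (D : schwarz_data R d).
Notation E := 'rV[R]_d.
Implicit Types (t : mesh D) (f g : E -> R) (x : E).
Hypothesis d_gt0 : (0 < d)%N.
Hypothesis polyD : polyhedral_domain D.
Hypothesis meshD : conforming_triangulation D.

Local Notation lam t := (bary (vtx D t)).
Local Notation indep := (vtx_indep meshD).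
Local Notation cellP := (cellP meshD).

Definition interp t f x : R := \sum_j lam t j x * f (vtx D t j).

Lemma interp_affine t f : exists (a : E) b, forall x, interp t f x = dot a x + b.
Proof.
have [a aE] := choice (fun j => bary_affine (vtx D t) j).
have [b bE] := choice aE.
exists (\sum_j f (vtx D t j) *: a j), (\sum_j f (vtx D t j) * b j) => x.
rewrite dot_suml -big_split/=; apply: eq_bigr => j _.
by rewrite dotZl bE; ring.
Qed.

Lemma interp_vtx t f j : interp t f (vtx D t j) = f (vtx D t j).
Proof.
rewrite /interp (bigD1 j)//= big1 ?addr0 => [|k kj]; rewrite bary_vtx ?indep//.
  by rewrite eqxx mul1r.
by rewrite (negPf kj) mul0r.
Qed.

(** Both interpolants are affine, and x is a combination of vertices at which they
    take the same values. *)
Lemma interp_face t t' f x (J : {set 'I_d.+1}) : face (vtx D t) J x ->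
  (forall j, j \in J -> interp t' f (vtx D t j) = f (vtx D t j)) ->
  interp t f x = interp t' f x.
Proof.
move=> /(faceP _ _ (indep t))[_ xJ] fJ.
have [a [b aE]] := interp_affine t' f.
rewrite aE (affine_bary (f := interp t' f) x (indep t)); last first.
  by move=> j; rewrite aE.
apply: eq_bigr => j _; have [jJ|jJ] := boolP (j \in J); first by rewrite fJ.
by rewrite xJ// !mul0r.
Qed.

Lemma interp_consistent t t' f x : cell t x -> cell t' x ->
  interp t f x = interp t' f x.
Proof.
move=> tx t'x; case: (meshD) => _ _ inter _ _.
apply: (interp_face (inter _ _ _ (conj tx t'x))) => j.
by rewrite inE => /existsP[k /eqP ->]; rewrite interp_vtx.
Qed.

(** The interpolants on the cells agree on common faces by conformity, so they
    define a function g on the closure of omega. It vanishes on the frontier: the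
    frontier is covered by faces contained in it, at whose vertices f vanishes.
    So g, extended by 0, is given by affine functions on finitely many closed
    sets that cover the space (the cells and the complement of omega), hence is
    continuous. *)
Lemma nodal_interpolation f : (forall x, ~ omega D x -> f x = 0) ->
  exists g, Vh D g /\ forall t x, cell t x -> g x = interp t f x.
Proof.
move=> f0; pose g x := if pselect (exists t, cell t x) is left h
  then interp (sval (cid h)) f x else 0.
have gE t x : cell t x -> g x = interp t f x.
  move=> tx; rewrite /g; case: pselect => [h|[]]; last by exists t.
  by apply: interp_consistent => //; exact: (svalP (cid h)).
have g0 x : ~ omega D x -> g x = 0.
  move=> nx; rewrite /g; case: pselect => // h; set t := sval _.
  have tx : cell t x := svalP (cid h).
  case: (meshD) => _ _ _ _ /(_ x)[].
    by split; [apply/(closure_omegaP meshD)|rewrite (interior_omega polyD)].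
  move=> t' [J [_ xJ Jfr]].
  have t'x : cell t' x by apply/cellP; exact: ((faceP _ _ (indep t')).1 xJ).1.
  rewrite (interp_consistent f tx t'x) /interp big1// => j _.
  have [jJ|jJ] := boolP (j \in J).
    rewrite f0 ?mulr0// => vo.
    have [|_] := Jfr (vtx D t' j); last by rewrite (interior_omega polyD).
    apply/faceP; [exact: indep|split=> k]; rewrite bary_vtx ?indep// ?ler0n//.
    by move=> kJ; rewrite (_ : (k == j) = false)//; apply: contraNF kJ => /eqP ->.
  by rewrite ((faceP _ _ (indep t')).1 xJ).2// mul0r.
exists g; split=> //; split=> //; last first.
  move=> t; have [a [b aE]] := interp_affine t f; exists a, b => x /gE ->.
  exact: aE.
move=> x B Bgx.
have near_t : \forall y \near x, forall t, cell t y -> B (g y).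
  apply: (@filter_forall _ _ (fun t => [set y | cell t y -> B (g y)]) (nbhs x)) => t.
  have [tx|ntx] := pselect (cell t x).
    have [a [b aE]] := interp_affine t f.
    have Bn : nbhs x [set y | B (dot a y + b)].
      by apply: (@affine_continuous _ _ a b x B); rewrite -aE -(gE t).
    by apply: (@filterS _ (nbhs x) _ _ _ _ Bn) => y By ty; rewrite (gE t)// aE.
  have nt : nbhs x (~` cell t).
    by apply: open_nbhs_nbhs; split=> //; apply: closed_openC; exact: cell_closed.
  by apply: (@filterS _ (nbhs x) _ _ _ _ nt) => y nty /nty.
have near_o : \forall y \near x, (forall t, ~ cell t y) -> B (g y).
  have [ox|nx] := pselect (omega D x).
    have nx : nbhs x (omega D).
      by apply: open_nbhs_nbhs; split=> //; case: polyD.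
    apply: (@filterS _ (nbhs x) _ _ _ _ nx) => y /subset_closure /(closure_omegaP meshD)[t ty] nt.
    by case: (nt t).
  have B0 : B 0 by move: Bgx; rewrite g0// => /nbhs_singleton.
  apply: (@nearW _ (nbhs x)) => y nt; rewrite g0// => /subset_closure.
  by move/(closure_omegaP meshD) => [t /nt].
apply: (@filterS2 _ (nbhs x) _ _ _ _ _ near_t near_o) => y Bt Bo.
have [[t ty]|nt] := pselect (exists t, cell t y); first exact: Bt ty.
by apply: Bo => t ty; apply: nt; exists t.
Qed.

Section partition.
Hypothesis pouD : partition_of_unity D.
Implicit Type i : 'I_(nsub D).

(** The open cell lies in omega, where theta_i >= 0, and theta_i is affine up to
    the vertex. (At a vertex on the frontier of omega, the sign is not part of
    the definition of a partition of unity.) *)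
Lemma theta_vtx_ge0 i t j : 0 <= theta D i (vtx D t j).
Proof.
case: (pouD) => _ aff th01 _ _; have [a [b aE]] := aff i t.
have thge0 x : (cell t)° x -> 0 <= theta D i x.
  by move=> /(open_cell_omega d_gt0 polyD meshD)/(th01 i)/andP[].
rewrite leNgt; apply/negP => neg.
set m := theta D i _ in neg.
have b0 := thge0 _ (barycenter_in d_gt0 meshD t).
set B := theta D i _ in b0.
(* the value of theta at (1 - s) vtx + s barycenter would be m / 2 < 0 *)
pose s := - m / (2 * (B - m)).
have s0 : 0 < s by rewrite divr_gt0//; lra.
have sE : s * (B - m) = - m / 2 by rewrite /s; field; lra.
have s1 : s < 1 by rewrite ltr_pdivrMr; lra.
pose x := (1 - s) *: vtx D t j + s *: barycenter t.
have tx : (cell t)° x.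
  apply/(open_cellP d_gt0 meshD) => k; have [a' [b' E']] := bary_affine (vtx D t) k.
  rewrite E' /x dotDr !dotZr.
  have := (open_cellP d_gt0 meshD t _).1 (barycenter_in d_gt0 meshD t) k.
  have : 0 <= bary (vtx D t) k (vtx D t j) by rewrite bary_vtx ?indep// ler0n.
  rewrite !E'; set u := dot _ _; set w := dot _ _ => u0 w0.
  have : 0 < s * (w + b') by rewrite mulr_gt0.
  have : 0 <= (1 - s) * (u + b') by rewrite mulr_ge0// subr_ge0 ltW.
  lra.
have := thge0 x tx.
rewrite aE; last exact: interior_subset.
have := aE _ (vtx_cell meshD t j); rewrite -/m => mE.
have := aE _ (interior_subset (barycenter_in d_gt0 meshD t)); rewrite -/B => BE.
rewrite /x dotDr !dotZr.
have -> : (1 - s) * dot a (vtx D t j) + s * dot a (barycenter t) + b =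
  m + s * (B - m) by rewrite mE BE; ring.
rewrite sE; lra.
Qed.

(** As theta_i is nonnegative at the vertices, theta_i (x) = 0 forces it to vanish
    at every vertex with a nonzero weight at x. So interpolation does not
    enlarge the support. *)
Lemma interp_theta0 i t e x : cell t x -> theta D i x = 0 ->
  interp t (theta D i \* e) x = 0.
Proof.
move=> tx; case: (pouD) => _ aff _ _ _.
rewrite (affine_on_bary meshD (aff i t) tx) => th0.
have tj0 j : 0 <= lam t j x * theta D i (vtx D t j).
  by rewrite mulr_ge0// ?theta_vtx_ge0//; exact: (cellP t x).1.
rewrite /interp big1// => j _ /=; rewrite mulrA.
have /allP/(_ j) := etrans (esym (psumr_eq0 _ (fun j _ => tj0 j))) (introT eqP th0).
by rewrite mem_index_enum => /(_ isT)/eqP ->; rewrite mul0r.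
Qed.

(** Where theta_i is nonzero in omega, it is nonzero on a neighbourhood, which is
    then contained in the support and so in the region. *)
Lemma theta_frontier i x : omega D x ->
  frontier (region (overlapping_subdomain i)) x -> theta D i x = 0.
Proof.
move=> ox [_ nint]; case: (pouD) => cont _ _ sup _; have [oo _ _] := polyD.
apply: contrapT => /eqP th; apply: nint.
have nx : nbhs x (omega D) by apply: open_nbhs_nbhs.
have cx : {for x, continuous (theta D i)}.
  have := continuous_subspaceW (@subset_closure _ (omega D)) (cont i).
  by rewrite continuous_open_subspace// => /(_ x); apply; rewrite inE.
have ne : \forall y \near x, theta D i y != 0.
  have /cx : nbhs (theta D i x) [set c | c != 0].
    by apply: open_nbhs_nbhs; split=> //; exact: open_neq.
  exact.
apply: (@filterS2 _ (nbhs x) _ _ _ _ _ nx ne) => y oy thy; apply: sup; apply: subset_closure.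
by split=> //; exact: subset_closure.
Qed.

Lemma interp_V0 i e g : Vh D g -> (forall x, ~ omega D x -> e x = 0) ->
  (forall t x, cell t x -> g x = interp t (theta D i \* e) x) -> V0 i g.
Proof.
move=> gV e0 gE; have [_ _ g0] := gV; exists g.
have van x : closure (omega D) x -> theta D i x = 0 -> g x = 0.
  by move=> /(closure_omegaP meshD)[t tx] th; rewrite (gE t)// interp_theta0.
split=> // x.
  move=> fx; have [ox|/g0//] := pselect (omega D x).
  by apply: van; [exact: subset_closure|exact: theta_frontier].
move=> nreg; have [ox|/g0//] := pselect (omega D x).
have cx : closure (omega D) x by exact: subset_closure.
apply: van => //; apply: contrapT => /eqP th; apply: nreg.
by case: pouD => _ _ _ sup _; apply: sup; exact: subset_closure.
Qed.

(** The theta_i add up to 1 at the vertices in omega, and e vanishes at the other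
    ones. *)
Lemma interp_partition e t x : Vh D e -> cell t x ->
  \sum_i interp t (theta D i \* e) x = e x.
Proof.
move=> [_ aff e0] tx; rewrite (affine_on_bary meshD (aff t) tx) exchange_big.
apply: eq_bigr => j _; rewrite -mulr_sumr -mulr_suml.
have [ov|/e0 ->] := pselect (omega D (vtx D t j)); last by rewrite mulr0.
by case: pouD => _ _ _ _ ->//; rewrite mul1r.
Qed.

End partition.
End interpolation.

(** * Finite element functions and local components *)

Section finite_elements.
Context {R : realType} {d : nat} (D : schwarz_data R d).
Notation E := 'rV[R]_d.
Implicit Types (t : mesh D) (f g e : E -> R) (x : E) (i : 'I_(nsub D)).
Hypothesis d_gt0 : (0 < d)%N.
Hypothesis polyD : polyhedral_domain D.
Hypothesis meshD : conforming_triangulation D.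

Lemma Vh_lin c f g : Vh D f -> Vh D g -> Vh D (fun x => c * f x + g x).
Proof.
move=> [cf af f0] [cg ag g0]; split.
- move=> x; apply: (@continuousD R R^o E (fun x => c * f x) g x); last exact: cg.
  by apply: (@continuousM R E (cst c) f x); [exact: cst_continuous|exact: cf].
- move=> t; have [a [b aE]] := af t; have [a' [b' aE']] := ag t.
  exists (c *: a + a'), (c * b + b') => x tx.
  by rewrite aE// aE'// dotDl dotZl; ring.
- by move=> x nx; rewrite f0// g0// mulr0 addr0.
Qed.

Lemma Vh0 : Vh D (cst 0).
Proof.
split=> // [x|t]; first exact: cst_continuous.
by exists 0, 0 => x _; rewrite addr0 /dot big1// => i _; rewrite mxE mul0r.
Qed.

(** A function of V_h is determined by its values at the vertices. *)
Lemma Vh_coordinates : exists n (F : 'rV[R]_n -> E -> R),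
  [/\ forall k c c' x, F (k *: c + c') x = k * F c x + F c' x,
      forall c, Vh D (F c) &
      forall f, Vh D f -> exists c, f = F c].
Proof.
pose V : set (E -> R^o) := Vh D.
have [||||es esV esP] := @finite_generation R (E -> R^o) V _
    (index_enum (mesh D * 'I_d.+1)%type) (fun p f => f (vtx D p.1 p.2)).
- exact: Vh0.
- by move=> c f g fV gV; exact: Vh_lin.
- by [].
- move=> f [_ af f0] fv; apply/funext => x.
  have [ox|/f0//] := pselect (omega D x).
  have /(closure_omegaP meshD)[t tx] := subset_closure ox.
  rewrite (affine_on_bary meshD (af t) tx) big1// => j _.
  by rewrite (fv (t, j)) ?mulr0// mem_index_enum.
pose F (c : 'rV[R]_(size es)) : E -> R := \sum_(i < size es) c ord0 i *: es`_i.
exists (size es), F; split.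
- move=> k c c' x; rewrite /F !fct_sumE mulr_sumr -big_split/=.
  apply: eq_bigr => i _.
  transitivity ((k * c ord0 i + c' ord0 i) * (es`_i : E -> R) x).
    by rewrite !mxE.
  by rewrite mulrDl -mulrA.
- move=> c; rewrite /F; elim/big_rec: _ => [|i f _ fV]; first exact: Vh0.
  exact: (Vh_lin (c ord0 i) (esV i) fV).
- by move=> f /esP/in_span_coord[c ->]; exists c.
Qed.

Section partition.
Hypothesis pouD : partition_of_unity D.
Variables (C C_I : R).
Hypothesis rhoD : admissible_coefficient D C.
Hypothesis stabD : interpolation_stable D C_I.

Let finvol t : finite_volume (cell t)° := finite_volume_cell d_gt0 meshD t.

Definition grad_theta2 (A : {set 'I_(nsub D)}) x : R :=
  \sum_(l in A) dot (grad (theta D l) x) (grad (theta D l) x).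

Lemma theta_affine i t : affine_on t (theta D i).
Proof. by case: pouD. Qed.

Lemma tame_grad_theta2 A t : tame (cell t)° (grad_theta2 A).
Proof.
by apply: (int_sum _ _ _ _).1 => // l; apply: tame_grad => //; exact: theta_affine.
Qed.

Lemma tame_mass A t f g : affine_on t f -> affine_on t g ->
  tame (cell t)° (fun x => rho D x * grad_theta2 A x * f x * g x).
Proof.
move=> af ag; apply: tameM; last exact: tame_affine.
apply: tameM; last exact: tame_affine.
by apply: tameM; [exact: (tame_rho d_gt0 polyD meshD rhoD)|exact: tame_grad_theta2].
Qed.

Lemma s_sub_sum i f g : piecewise_affine D f -> piecewise_affine D g ->
  s_sub i f g = \sum_(t in subdomain i) lebesgue_int (cell t)°
    (fun x => rho D x * grad_theta2 (neighbours i) x * f x * g x).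
Proof. by move=> pf pg; apply: open_cells_sum => // t _; exact: tame_mass. Qed.

(** If l is not a neighbour of i, then theta_l vanishes on the subdomain i. *)
Lemma grad_theta2_neighbours i t x : t \in subdomain i -> (cell t)° x ->
  grad_theta2 (neighbours i) x = grad_theta2 [set: 'I_(nsub D)]%SET x.
Proof.
move=> ti tx; rewrite /grad_theta2 big_mkcond [RHS]big_mkcond.
apply: eq_bigr => l _; rewrite finset.in_setT; case: ifPn => // nl.
suff -> : grad (theta D l) x = 0 by rewrite /dot big1// => j _; rewrite mxE mul0r.
apply: (grad_affine_on (t := t) (b := 0)) => // y ty.
rewrite addr0 /dot big1 => [|j _]; last by rewrite mxE mul0r.
apply: contrapT => /eqP th; move: nl; rewrite inE => /negP; apply.
apply/asboolP; exists y; split; last by exists t.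
by apply: subset_closure; split=> //; apply/(closure_omegaP meshD); exists t.
Qed.

Lemma s_sub_psd i (U : lmodType R) (F : U -> E -> R) :
  (forall c, piecewise_affine D (F c)) ->
  (forall k c c' x, F (k *: c + c') x = k * F c x + F c' x) ->
  psd_form (fun c c' => s_sub i (F c) (F c')).
Proof.
move=> pF lF.
rewrite (_ : (fun c c' => _) = fun c c' => \sum_(t in subdomain i)
    lebesgue_int (cell t)° (fun x => rho D x * grad_theta2 (neighbours i) x *
      F c x * F c' x)); last first.
  by apply/funext => c; apply/funext => c'; exact: s_sub_sum.
apply: psd_sum => t; split=> [c c'|k c c' e|c].
- by apply: eq_int => x _; rewrite mulrAC.
- have te h := tame_mass (neighbours i) (pF h t) (pF e t).
  rewrite -(intZ (finvol t))// -(intD (finvol t))//.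
    by apply: eq_int => x _; rewrite lF; ring.
  exact: tameM (tame_cst _ k) (te c).
- apply: int_ge0 => x tx; rewrite -mulrA -expr2 mulr_ge0 ?sqr_ge0//.
  rewrite mulr_ge0 ?(ltW (rho_gt0 d_gt0 polyD meshD rhoD tx))//.
  by apply: sumr_ge0 => l _; exact: dot_ge0.
Qed.

(** Stability of interpolation is about integrals without weight. As rho varies by
    a factor of at most C on the open cell, it can be replaced by its value at
    the barycenter before, and put back after, at the price of C each time. The
    factor 2 comes from the two terms of the product rule. *)
Lemma interp_energy t p q g : affine_on t p -> affine_on t q ->
  nodal_interpolant t (p \* q) g ->
  lebesgue_int (cell t)° (fun x => rho D x * dot (grad g x) (grad g x)) <=
  2 * C ^+ 2 * C_I ^+ 2 * lebesgue_int (cell t)° (fun x => rho D x *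
    (dot (grad p x) (grad p x) * q x ^+ 2 + p x ^+ 2 * dot (grad q x) (grad q x))).
Proof.
move=> ap aq gI; have [ag _] := gI; have fv := finvol t.
have [H1g _] := stabD ap aq gI.
have tp := tame_affine meshD ap; have tq := tame_affine meshD aq.
have tgg := tame_grad ag ag; have tpp := tame_grad ap ap.
have tqq := tame_grad aq aq.
have trho := tame_rho d_gt0 polyD meshD rhoD t.
have gradM x : (cell t)° x ->
    grad (p \* q) x = p x *: grad q x + q x *: grad p x.
  move=> tx; have [a [b aE]] := ap; have [a' [b' aE']] := aq.
  rewrite (grad_affine_on aE tx) (grad_affine_on aE' tx).
  have tx' := interior_subset tx.
  rewrite aE// aE'// -grad_affineM; apply: eq_grad.
  by apply: near_cell tx _ => y ty /=; rewrite aE// aE'.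
pose G x := dot (grad (p \* q) x) (grad (p \* q) x).
pose G' x := dot (grad p x) (grad p x) * q x ^+ 2 +
             p x ^+ 2 * dot (grad q x) (grad q x).
have tG' : tame (cell t)° G'.
  exact: (tameD (tameM tpp (tame_sqr tq)) (tameM (tame_sqr tp) tqq)).
have tpq := tame_grad ap aq.
have tG : tame (cell t)° G.
  apply: (@eq_tame _ _ _ (fun x => p x * p x * dot (grad q x) (grad q x) +
      (2 * p x * q x * dot (grad p x) (grad q x) +
       q x * q x * dot (grad p x) (grad p x)))).
    move=> x; rewrite inE => /gradM; rewrite /G => ->.
    by rewrite !(dotDl, dotDr, dotZl, dotZr) (dotC (grad q x) (grad p x)); ring.
  apply: tameD (tameM (tameM tp tp) tqq) (tameD _ (tameM (tameM tq tq) tpp)).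
  exact: tameM (tameM (tameM (tame_cst _ 2) tp) tq) tpq.
have GG' x : (cell t)° x -> G x <= 2 * G' x.
  move=> /gradM; rewrite /G => ->; rewrite -subr_ge0.
  have := dot_ge0 (p x *: grad q x + (- q x) *: grad p x); congr (0 <= _).
  by rewrite /G' !(dotDl, dotDr, dotZl, dotZr) (dotC (grad q x) (grad p x)); ring.
have rho0 x : (cell t)° x -> 0 < rho D x by exact: (rho_gt0 d_gt0 polyD meshD rhoD).
case: (rhoD) => _ _ /(_ t) osc.
have bt := barycenter_in d_gt0 meshD t.
set r := rho D (barycenter t).
have r0 : 0 < r by exact: rho0.
have C0 : 0 <= C by rewrite -(pmulr_lge0 C r0) (le_trans (ltW r0))//; exact: osc.
have stab : lebesgue_int (cell t)° (fun x => dot (grad g x) (grad g x)) <=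
    C_I ^+ 2 * lebesgue_int (cell t)° G.
  have Gg0 : 0 <= lebesgue_int (cell t)° (fun x => dot (grad g x) (grad g x)).
    by apply: int_ge0 => x _; exact: dot_ge0.
  have GG0 : 0 <= lebesgue_int (cell t)° G by apply: int_ge0 => x _; exact: dot_ge0.
  rewrite -(sqr_sqrtr Gg0) -(sqr_sqrtr GG0) -exprMn.
  by rewrite ler_sqr ?nnegrE ?sqrtr_ge0// (le_trans (sqrtr_ge0 _) H1g).
apply: (@le_trans _ _ (C * r * lebesgue_int (cell t)° (fun x => dot (grad g x) (grad g x)))).
  rewrite -(intZ fv)//; apply: (le_int fv) => [||x tx].
  - exact: tameM trho tgg.
  - exact: tameM (tame_cst _ _) tgg.
  - by rewrite ler_wpM2r ?dot_ge0//; exact: osc.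
apply: (@le_trans _ _ (C * C_I ^+ 2 * lebesgue_int (cell t)° (fun x => r * G x))).
  rewrite (intZ fv)// (_ : C * C_I ^+ 2 * _ = C * r * (C_I ^+ 2 * lebesgue_int (cell t)° G)).
    by rewrite ler_wpM2l// mulr_ge0// ltW.
  by ring.
rewrite (_ : 2 * C ^+ 2 * C_I ^+ 2 * _ =
    C * C_I ^+ 2 * (2 * C * lebesgue_int (cell t)° (fun x => rho D x * G' x))); last by ring.
apply: ler_wpM2l; first by rewrite mulr_ge0 ?sqr_ge0.
rewrite -(intZ fv); last exact: tameM trho tG'.
apply: (le_int fv) => [||x tx].
- exact: tameM (tame_cst _ _) tG.
- exact: tameM (tame_cst _ _) (tameM trho tG').
- have rC : r <= C * rho D x by exact: osc.
  apply: (@le_trans _ _ (C * rho D x * G x)).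
    by rewrite ler_wpM2r ?dot_ge0.
  rewrite (_ : 2 * C * _ = C * rho D x * (2 * G' x)); last by ring.
  by rewrite ler_wpM2l ?mulr_ge0// ?GG'// ltW ?rho0.
Qed.

Lemma sum_cells_subdomain (h : mesh D -> R) :
  \sum_t h t = \sum_(i < nsub D) \sum_(t in subdomain i) h t.
Proof.
rewrite (partition_big (dom D) xpredT)//; apply: eq_bigr => i _.
by apply: eq_bigl => t; rewrite !inE.
Qed.

(** The energies on a cell are added up over i: the squares of the theta_i add up
    to at most the sum of the theta_i, which is 1, and the |grad theta_i|^2 to
    the weight of s_k on the subdomain k of the cell. *)
Lemma decomposition_energy e (us : 'I_(nsub D) -> E -> R) : Vh D e ->
  (forall i t, nodal_interpolant t (theta D i \* e) (us i)) ->
  \sum_i a_form D (us i) (us i) <=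
  2 * C ^+ 2 * C_I ^+ 2 * (\sum_(i < nsub D) s_sub i e e + a_form D e e).
Proof.
move=> [_ ae _] usI; set K := 2 * _ * _.
have pus i : piecewise_affine D (us i) by move=> t; exact: (usI i t).1.
pose A := [set: 'I_(nsub D)]%SET.
have -> : \sum_(i < nsub D) s_sub i e e = \sum_(t : mesh D) lebesgue_int (cell t)°
    (fun x => rho D x * grad_theta2 A x * e x * e x).
  rewrite sum_cells_subdomain; apply: eq_bigr => i _; rewrite s_sub_sum//.
  apply: eq_bigr => t ti; apply: eq_int => x; rewrite inE => tx.
  by rewrite (grad_theta2_neighbours ti tx).
have aE f : piecewise_affine D f -> a_form D f f =
    \sum_(t : mesh D) lebesgue_int (cell t)° (fun x => rho D x * dot (grad f x) (grad f x)).
  move=> pf; rewrite /a_form (a_on_sum d_gt0 polyD meshD rhoD)//.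
  by apply: eq_bigl => t; rewrite finset.in_setT.
rewrite (eq_bigr _ (fun i _ => aE _ (pus i))) (aE e ae).
rewrite exchange_big -big_split/= mulr_sumr; apply: ler_sum => t _.
have fv := finvol t; have ath i := theta_affine i t.
apply: le_trans (ler_sum _ (fun i _ => interp_energy (ath i) (ae t) (usI i t))) _.
rewrite -mulr_sumr -/K; apply: ler_wpM2l.
  by apply: mulr_ge0 (sqr_ge0 _); apply: mulr_ge0 (sqr_ge0 _).
have trho := tame_rho d_gt0 polyD meshD rhoD t.
have tth i := tame_affine meshD (ath i).
have te := tame_affine meshD (ae t).
have tterm i : tame (cell t)° (fun x => rho D x *
    (dot (grad (theta D i) x) (grad (theta D i) x) * e x ^+ 2 +
     theta D i x ^+ 2 * dot (grad e x) (grad e x))).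
  have tg := tame_grad (ath i) (ath i); have tg' := tame_grad (ae t) (ae t).
  exact: tameM trho (tameD (tameM tg (tame_sqr te)) (tameM (tame_sqr (tth i)) tg')).
have tm := tame_mass A (ae t) (ae t).
have tE := tame_energy d_gt0 polyD meshD rhoD (ae t) (ae t).
have [tS <-] := int_sum fv (index_enum _) xpredT tterm.
rewrite -(intD fv)//; apply: (le_int fv) => //; first exact: tameD tm tE.
move=> x tx; rewrite -mulr_sumr -!mulrA -mulrDr.
apply: ler_wpM2l; first exact/ltW/(rho_gt0 d_gt0 polyD meshD rhoD tx).
rewrite big_split/= -!mulr_suml -expr2 lerD//.
  rewrite le_eqVlt; apply/orP; left; apply/eqP; congr (_ * _).
  by apply: eq_bigl => i; rewrite finset.in_setT.
have ox := open_cell_omega d_gt0 polyD meshD tx.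
rewrite ler_piMl ?dot_ge0//; case: pouD => _ _ th01 _ th1.
rewrite -(th1 x ox); apply: ler_sum => i _; have /andP[h0 h1] := th01 i x ox.
by rewrite expr2 ler_piMl.
Qed.

End partition.
End finite_elements.

(** * The global coarse space *)

Section coarse_space.
Context {R : realType} {d : nat} (D : schwarz_data R d).
Notation E := 'rV[R]_d.
Variables (Lam C_rho : R) (l : 'I_(nsub D) -> nat)
  (lambda : forall i, 'I_(l i) -> R) (phi psi : forall i, 'I_(l i) -> E -> R).
Hypotheses (Lam_gt0 : 0 < Lam) (d_gt0 : (0 < d)%N)
  (polyD : polyhedral_domain D) (meshD : conforming_triangulation D)
  (pouD : partition_of_unity D) (rhoD : admissible_coefficient D C_rho)
  (phiP : forall i, low_eigenfunctions Lam i (@lambda i) (@phi i))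
  (psiP : forall i j, energy_minimizer phi j (@psi i j)).

Section coordinates.
Variables (n : nat) (F : 'rV[R]_n -> E -> R).
Hypotheses (linF : forall k c c' x, F (k *: c + c') x = k * F c x + F c' x)
  (VF : forall c, Vh D (F c)) (surjF : forall f, Vh D f -> exists c, f = F c).

Let pF c : piecewise_affine D (F c).
Proof. by have [] := VF c. Qed.

Let VsubF (i : 'I_(nsub D)) c : V_sub i (F c).
Proof. by exists (F c). Qed.

Lemma a_coord_psd (S : {set mesh D}) : psd_form (fun c c' => a_on S (F c) (F c')).
Proof. exact: (a_on_psd d_gt0 polyD meshD rhoD S pF linF). Qed.

Definition s_coord (i : 'I_(nsub D)) c c' : R := s_sub i (F c) (F c').

Lemma s_coord_psd i : psd_form (s_coord i).
Proof. exact: (s_sub_psd d_gt0 polyD meshD pouD rhoD i pF linF). Qed.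

Lemma coord_sum (I : finType) (f : I -> 'rV[R]_n) (k : I -> R) x :
  F (\sum_i k i *: f i) x = \sum_i k i * F (f i) x.
Proof.
elim/big_rec2: _ => [|i y1 y2 _ <-]; last by rewrite linF.
by have := linF (-1) 0 0 x; rewrite scaler0 addr0 mulN1r addNr.
Qed.

(** An eigenfunction on a subdomain only has to agree with some function of
    V_h there; the coordinates of such a function can replace it, since the
    forms of the subdomain do not see the values elsewhere. *)
Lemma eigenfunction_coord : exists p : forall i, 'I_(l i) -> 'rV[R]_n,
  forall i j x, region (subdomain i) x -> phi j x = F (p i j) x.
Proof.
have h i (j : 'I_(l i)) : exists c, forall x,
    region (subdomain i) x -> phi j x = F c x.
  have [/(_ j)[[[g Vg gE] _] _] _ _ _] := phiP i.
  by have [c cE] := surjF Vg; exists c => x /gE ->; rewrite cE.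
by exists (fun i j => sval (cid (h i j))) => i j; exact: svalP (cid (h i j)).
Qed.

Variable p : forall i, 'I_(l i) -> 'rV[R]_n.
Hypothesis pE : forall i (j : 'I_(l i)) x,
  region (subdomain i) x -> phi j x = F (p j) x.

Lemma s_sub_phi i c (j : 'I_(l i)) :
  s_sub i (F c) (phi j) = s_coord i c (p j).
Proof. by apply: eq_s_sub => //; exact: pE. Qed.

Lemma s_coord_ortho i (j j' : 'I_(l i)) : s_coord i (p j) (p j') = (j == j')%:R.
Proof.
by have [_ _ <- _] := phiP i; apply: eq_s_sub => y Sy; rewrite pE.
Qed.

Lemma subdomain_gap i c :
  Lam * (s_coord i c c - \sum_j s_coord i c (p (i := i) j) ^+ 2)
    <= a_sub i (F c) (F c).
Proof.
apply: (spectral_gap (a_coord_psd _) (s_coord_psd i) (@in_span_rV _ _)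
  (@s_coord_ortho i) (lam := @lambda i)).
  move=> j x; have [/(_ j)[[_ eig] _] _ _ _] := phiP i.
  have := eig _ (VsubF i x); rewrite /a_sub.
  rewrite (eq_a_on (f := phi j) (f' := F (p j)) (@pE i j) (fun _ _ => erefl)).
  by rewrite (eq_s_sub (f := phi j) (f' := F (p j)) (@pE i j) (fun _ _ => erefl)).
move=> mu f eig muL sf; have [_ _ _ complete] := phiP i.
apply: (complete mu) => // [|j]; last by rewrite s_sub_phi; exact: sf.
split=> // w [g Vg gE]; have [b bE] := surjF Vg.
have wE y : region (subdomain i) y -> w y = F b y by move/gE; rewrite bE.
rewrite /a_sub (eq_a_on (f' := F f) (fun _ _ => erefl) wE) eig.
by rewrite (eq_s_sub (f' := F f) (fun _ _ => erefl) wE).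
Qed.

(** By s_k-orthonormality, s_k (pi_k f, pi_k f) is the sum of the squares of the
    coefficients of pi_k f, so the energy is quadratic in f plus a linear
    term and a constant, the form that [minimizer_eq] deals with. *)
Lemma energy_coord i (j : 'I_(l i)) c : energy phi j (F c) =
  a_form D (F c) (F c) + \sum_k \sum_h s_coord k c (p (i := k) h) ^+ 2
    - 2 * s_coord i c (p j) + 1.
Proof.
pose alpha k h := s_coord k c (p (i := k) h).
have projE k x : region (subdomain k) x -> spectral_proj phi k (F c) x =
    F (\sum_h alpha k h *: p h) x.
  move=> Sx; rewrite /spectral_proj coord_sum; apply: eq_bigr => h _.
  by rewrite s_sub_phi pE.
have sP k (h : 'I_(l k)) :
    s_coord k (\sum_h alpha k h *: p h) (p h) = alpha k h.
  rewrite (psd_suml _ _ (s_coord_psd k)) (bigD1 h)//= big1 => [|h' hh'].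
    by rewrite (psd_Zl _ _ _ (s_coord_psd k)) s_coord_ortho eqxx mulr1 addr0.
  by rewrite (psd_Zl _ _ _ (s_coord_psd k)) s_coord_ortho (negPf hh') mulr0.
have sprojE k : s_coord k (\sum_h alpha k h *: p h) (\sum_h alpha k h *: p h)
    = \sum_h alpha k h ^+ 2.
  rewrite (psd_suml _ _ (s_coord_psd k)); apply: eq_bigr => h _.
  by rewrite (psd_Zl _ _ _ (s_coord_psd k)) (psd_sym _ _ (s_coord_psd k)) sP.
have sumE : \sum_(k | k != i)
    s_sub k (spectral_proj phi k (F c)) (spectral_proj phi k (F c)) =
    \sum_(k | k != i) \sum_h alpha k h ^+ 2.
  by apply: eq_bigr => k _; rewrite -sprojE; apply: eq_s_sub; exact: projE.
rewrite /energy sumE [in RHS](bigD1 i)//=; pose P := \sum_h alpha i h *: p h.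
have -> : s_sub i (spectral_proj phi i (F c) \- phi j)
    (spectral_proj phi i (F c) \- phi j) = s_coord i (P - p j) (P - p j).
  have PE x : region (subdomain i) x ->
      (spectral_proj phi i (F c) \- phi j) x = F (P - p j) x.
    move=> Sx; rewrite /= projE// pE// -/P (addrC P) -(scaleN1r (p j)) linF.
    by ring.
  exact: eq_s_sub.
rewrite -(scaleN1r (p j)) (psd_sqD _ _ _ (s_coord_psd i)) sprojE sP.
by rewrite s_coord_ortho eqxx /alpha /=; ring.
Qed.

End coordinates.

(** [coarse_projection] bounds the energy of u - u0 and the sum of the
    s_k (pi_k (u - u0), pi_k (u - u0)); [subdomain_gap] bounds the rest of each
    s_k (u - u0, u - u0) by the energy on the subdomain k. *)
Lemma coarse_component u : Vh D u -> exists u0,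
  [/\ V_glb psi u0, Vh D (fun x => u x - u0 x),
      a_form D u0 u0 + a_form D (fun x => u x - u0 x) (fun x => u x - u0 x)
        <= a_form D u u &
      \sum_(i < nsub D) s_sub i (fun x => u x - u0 x) (fun x => u x - u0 x)
        <= (1 + Lam^-1) * a_form D u u].
Proof.
have [n [F [linF VF surjF]]] := Vh_coordinates meshD.
have [p pE] := eigenfunction_coord surjF.
have aP S := a_coord_psd linF VF S; have sP i := s_coord_psd linF VF i.
pose alpha i (j : 'I_(l i)) c := s_coord F i c (p i j).
move=> /surjF[c ->].
have [q qE] : exists q : forall i, 'I_(l i) -> 'rV[R]_n,
    forall i j, psi j = F (q i j).
  have h i (j : 'I_(l i)) : exists c, psi j = F c.
    by apply: surjF; have [] := psiP j.
  by exists (fun i j => sval (cid (h i j))) => i j; exact: svalP (cid (h i j)).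
pose c0 := \sum_i \sum_j alpha i j c *: q i j.
have pyth : a_form D (F c0) (F c0) + a_form D (F (c - c0)) (F (c - c0)) +
    2 * (\sum_i \sum_j alpha i j (c - c0) ^+ 2) = a_form D (F c) (F c).
  apply: (coarse_projection (aP [set: mesh D]%SET) (alpha := alpha) (psi := q)).
    by move=> i j k x y; rewrite /alpha (psd_Dl _ _ _ (sP i)) (psd_Zl _ _ _ (sP i)).
  move=> i j x; have [_ /(_ _ (VF x))] := psiP j.
  by rewrite qE !(energy_coord linF VF pE j) lerD2r.
have a0 x : 0 <= a_form D (F x) (F x) := psd_ge0 x (aP _).
have alpha0 : 0 <= \sum_i \sum_j alpha i j (c - c0) ^+ 2.
  by apply: sumr_ge0 => i _; apply: sumr_ge0 => j _; exact: sqr_ge0.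
have [alphaA eA] : \sum_i \sum_j alpha i j (c - c0) ^+ 2 <= a_form D (F c) (F c)
    /\ a_form D (F (c - c0)) (F (c - c0)) <= a_form D (F c) (F c).
  move: (a0 c0) (a0 (c - c0)) alpha0 pyth.
  move: (a_form D (F c0) (F c0)) (a_form D (F (c - c0)) (F (c - c0))) => x y.
  by move: (\sum_i _) (a_form D (F c) (F c)) => z w; lra.
have eE : (fun x => F c x - F c0 x) = F (c - c0).
  by apply/funext => x; rewrite (addrC c) -(scaleN1r c0) linF; ring.
exists (F c0); rewrite eE; split.
- exists (fun i j => alpha i j c) => x; rewrite /c0.
  under eq_bigr do rewrite -[\sum_j _]scale1r.
  rewrite (coord_sum linF); apply: eq_bigr => i _; rewrite mul1r (coord_sum linF).
  by apply: eq_bigr => j _; rewrite qE.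
- exact: VF.
- by rewrite -pyth lerDl mulr_ge0.
have Lam0 : 0 < Lam^-1 by rewrite invr_gt0.
apply: (@le_trans _ _ (\sum_i (\sum_j alpha i j (c - c0) ^+ 2 +
    Lam^-1 * a_sub i (F (c - c0)) (F (c - c0))))).
  apply: ler_sum => i _; rewrite -lerBlDl (ler_pdivlMl _ _ Lam_gt0).
  exact: (subdomain_gap linF VF surjF pE i (c - c0)).
rewrite big_split/= -mulr_sumr -(a_form_split d_gt0 polyD meshD rhoD).
- rewrite mulrDl mul1r; apply: lerD; first exact: alphaA.
  by apply: ler_wpM2l; [exact: ltW|exact: eA].
- by have [] := VF (c - c0).
- by have [] := VF (c - c0).
Qed.

End coarse_space.

(** * The stable decomposition *)

Theorem lemma4p1 (R : realType) (Lambda C_rho C_I : R) (M : nat)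
    (Lambda_gt0 : 0 < Lambda) :
  exists C0 : R,
  forall (r : nat) (D : schwarz_data R r)
    (l : 'I_(nsub D) -> nat)
    (lambda : forall i, 'I_(l i) -> R)
    (phi psi : forall i, 'I_(l i) -> 'rV[R]_r -> R),
  (0 < r)%N ->
  polyhedral_domain D ->
  conforming_triangulation D ->
  admissible_coefficient D C_rho ->
  interpolation_stable D C_I ->
  subdomain_partition D ->
  (forall i : 'I_(nsub D), (0 < layers D i)%N) ->
  overlap_bound D M ->
  partition_of_unity D ->
  (forall i, low_eigenfunctions Lambda i (lambda i) (phi i)) ->
  (forall i j, energy_minimizer phi j (psi i j)) ->
  forall u, Vh D u ->
  exists (u0 : 'rV[R]_r -> R) (us : 'I_(nsub D) -> 'rV[R]_r -> R),
    [/\ V_glb psi u0,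
        forall i, V0 i (us i),
        forall x, u x = \sum_i us i x + u0 x &
        \sum_i a_form D (us i) (us i) + a_form D u0 u0 <= C0 ^+ 2 * a_form D u u].
Proof.
pose K := 2 * C_rho ^+ 2 * C_I ^+ 2.
have K0 : 0 <= K by apply: mulr_ge0 (sqr_ge0 _); apply: mulr_ge0 (sqr_ge0 _).
have L0 : 0 < Lambda^-1 by rewrite invr_gt0.
exists (Num.sqrt (1 + K * (2 + Lambda^-1))).
move=> r D l lambda phi psi r0 polyD meshD rhoD stabD _ _ _ pouD phiP psiP u Vu.
have [u0 [u0V eV engy mass]] :=
  coarse_component Lambda_gt0 r0 polyD meshD pouD rhoD phiP psiP Vu.
set e := fun x => u x - u0 x in eV engy mass.
have [_ _ e0] := eV.
have /choice[us usP] (i : 'I_(nsub D)) : exists g, Vh D g /\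
    forall (t : mesh D) x, cell t x -> g x = interp t (theta D i \* e) x.
  by apply: nodal_interpolation => // x nx /=; rewrite e0// mulr0.
have Vus i : Vh D (us i) := (usP i).1.
exists u0, us; split=> [|i|x|]; first exact: u0V.
- exact: (interp_V0 r0 polyD meshD pouD (Vus i) e0 (usP i).2).
- apply/eqP; rewrite -subr_eq eq_sym; apply/eqP; rewrite -[RHS]/(e x).
  have [ox|nx] := pselect (omega D x); last first.
    by rewrite e0// big1// => i _; have [_ _ ->] := Vus i.
  have /(closure_omegaP meshD)[t tx] := subset_closure ox.
  rewrite -(interp_partition meshD pouD eV tx).
  by apply: eq_bigr => i _; exact: (usP i).2.
have := decomposition_energy r0 polyD meshD pouD rhoD stabD eV (us := us).
have nodal (i : 'I_(nsub D)) (t : mesh D) : nodal_interpolant t (theta D i \* e) (us i).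
  split=> [|j]; first by have [_ /(_ t)] := Vus i.
  by rewrite ((usP i).2 t) ?(interp_vtx meshD)//; exact: vtx_cell.
move=> /(_ nodal); rewrite -/K => local.
have a0 v : Vh D v -> 0 <= a_form D v v.
  move=> [_ pv _]; apply: int_ge0 => x [t _ tx].
  by rewrite mulr_ge0 ?dot_ge0// ltW// (rho_gt0 r0 polyD meshD rhoD tx).
have u00 : 0 <= a_form D u0 u0.
  apply: int_ge0 => x [t _ tx].
  by rewrite mulr_ge0 ?dot_ge0// ltW// (rho_gt0 r0 polyD meshD rhoD tx).
have au := a0 _ Vu; have ae := a0 _ eV.
rewrite sqr_sqrtr; last by rewrite addr_ge0// mulr_ge0// addr_ge0// ltW.
have SA : \sum_(i < nsub D) s_sub i e e + a_form D e e <=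
    (2 + Lambda^-1) * a_form D u u.
  rewrite (_ : 2 + Lambda^-1 = 1 + Lambda^-1 + 1); last by ring.
  rewrite [leRHS]mulrDl mul1r; apply: lerD; first exact: mass.
  by apply: le_trans engy; rewrite lerDr; exact: u00.
rewrite mulrDl mul1r addrC -mulrA; apply: lerD.
  by apply: le_trans engy; rewrite lerDl; exact: ae.
by apply: le_trans local _; apply: ler_wpM2l; [exact: K0|exact: SA].
Qed.
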